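(* Let $G_m$ be a bounded Vilenkin group. a) The maximal operator $$\widetilde{L}^{*}f:=\sup_{n\in\mathbb{N}_+}\frac{|L_nf|}{\log(n+1)}$$ is bounded from the Hardy space $H_1(G_m)$ to the space $L_1(G_m)$; that is, there is a constant $C$ such that $\|\widetilde{L}^{*}f\|_1\le C\|f\|_{H_1}$ for all $f\in H_1(G_m)$. b) Let $\varphi:\mathbb{N}_+\to[1,\infty)$ be a nondecreasing function satisfying $$\limsup_{n\to\infty}\frac{\log(n+1)}{\varphi(n)}=+\infty .$$ Then the maximal operator $$f\mapsto \sup_{n\in\mathbb{N}_+}\frac{|L_nf|}{\varphi(n)}$$ is not bounded from the Hardy space $H_1(G_m)$ to the Lebesgue space $L_1(G_m)$; that is, there is no constant $C$ such that $\left\|\sup_{n\in\mathbb{N}_+}|L_nf|/\varphi(n)\right\|_1\le C\|f\|_{H_1}$ for all $f\in H_1(G_m)$.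
   Context: $\mathbb{N}_+$ is the set of positive integers, $\mathbb{N}=\mathbb{N}_+\cup\{0\}$. Vilenkin group. Let $m=(m_0,m_1,\dots)$ be a sequence of integers $m_k\ge 2$, and $Z_{m_k}=\{0,1,\dots,m_k-1\}$ the additive group of integers modulo $m_k$ with the discrete topology. $G_m$ is the complete direct product of the groups $Z_{m_k}$, with the product topology; its elements are sequences $x=(x_0,x_1,\dots)$, $x_k\in Z_{m_k}$. $\mu$ is the normalized Haar measure on $G_m$, i.e. the product of the measures $\mu_k(\{j\})=1/m_k$. $G_m$ is called bounded if $\sup_n m_n<\infty$. For $x\in G_m$ put $I_0(x)=G_m$ and $I_n(x)=\{y\in G_m: y_0=x_0,\dots,y_{n-1}=x_{n-1}\}$. Vilenkin system. Let $M_0=1$, $M_{k+1}=m_kM_k$. Every $n\in\mathbb{N}$ is uniquely $n=\sum_{k=0}^\infty n_kM_k$ with $n_k\in Z_{m_k}$ and only finitely many $n_k\neq 0$. Let $r_k(x)=\exp(2\pi i x_k/m_k)$ and $\psi_n(x)=\prod_{k=0}^\infty r_k(x)^{n_k}$. Fourier series. For $f\in L_1(G_m)$ let $\widehat f(n)=\int_{G_m} f\,\overline{\psi_n}\,d\mu$ and $S_nf=\sum_{k=0}^{n-1}\widehat f(k)\psi_k$ (so $S_0f=0$). The Nörlund logarithmic means are, for $n\in\mathbb{N}_+$, $$L_nf=\frac1{l_n}\sum_{k=0}^{n-1}\frac{S_kf}{n-k},\qquad l_n=\sum_{k=1}^n\frac1k .$$ $\|f\|_1=\int_{G_m}|f|\,d\mu$.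 Hardy space. The maximal function of $f\in L_1(G_m)$ is $f^*(x)=\sup_{n\in\mathbb{N}}\frac{1}{\mu(I_n(x))}\left|\int_{I_n(x)}f\,d\mu\right|$. The martingale Hardy space $H_1(G_m)$ consists of all martingales $f$ (with respect to the filtration generated by the sets $I_n(x)$) for which $\|f\|_{H_1}:=\|f^*\|_1<\infty$; such martingales are identified with functions $f\in L_1(G_m)$ with $f^*\in L_1(G_m)$. *)

(* Defs.v *)
From HB Require Import structures.
From mathcomp Require Import all_boot all_order all_algebra.
From mathcomp Require Import complex.
From mathcomp Require Import all_classical all_reals all_analysis.
From mathcomp Require Import measurable_realfun.

Set Implicit Arguments.
Unset Strict Implicit.
Unset Printing Implicit Defensive.

Import Order.TTheory GRing.Theory Num.Theory.
Import numFieldNormedType.Exports.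
Import ComplexField.

Local Open Scope classical_set_scope.
Local Open Scope ring_scope.

(** Integrals of complex-valued functions (MathComp-Analysis integrates
    functions with values in [\bar R] or [R] only). *)

Definition cintegrable d (T : measurableType d) (R : realType)
    (mu : {measure set T -> \bar R}) (D : set T) (f : T -> R[i]) : Prop :=
  mu.-integrable D (fun x => (complex.Re (f x))%:E) /\
  mu.-integrable D (fun x => (complex.Im (f x))%:E).

Definition cintegral d (T : measurableType d) (R : realType)
    (mu : {measure set T -> \bar R}) (D : set T) (f : T -> R[i]) : R[i] :=
  Complex (Rintegral mu D (fun x => complex.Re (f x)))
          (Rintegral mu D (fun x => complex.Im (f x))).

(** [\|g\|_1] for extended real-valued [g]: maximal functions are suprema of
    sequences, hence may take the value [+oo]. *)
Definition norm1 d (T : measurableType d) (R : realType)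
    (mu : {measure set T -> \bar R}) (g : T -> \bar R) : \bar R :=
  (\int[mu]_x `|g x|)%E.

(** For [1 < m k], ['Z_(m k)] is the ring of integers modulo [m k], with
    underlying type ['I_(m k)]. *)
Definition residue_seq (m : nat -> nat) : Type := forall k, 'Z_(m k).

HB.instance Definition _ m := gen_eqMixin (residue_seq m).
HB.instance Definition _ m := gen_choiceMixin (residue_seq m).
HB.instance Definition _ m :=
  isPointed.Build (residue_seq m) (fun k => 0 : 'Z_(m k)).

Definition cylinder (m : nat -> nat) (n : nat) (x : residue_seq m) :
    set (residue_seq m) :=
  [set y | forall k, (k < n)%N -> y k = x k].

Definition cylinders (m : nat -> nat) : set (set (residue_seq m)) :=
  [set A | exists n x, A = cylinder n x].

(** The product sigma-algebra; as a countable product of finite discrete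
    spaces is second countable with base the cylinders, it is also the Borel
    sigma-algebra of the product topology. *)
Definition vilenkin (m : nat -> nat) := g_sigma_algebraType (@cylinders m).

HB.instance Definition _ m := Pointed.on (vilenkin m).
HB.instance Definition _ m := Measurable.on (vilenkin m).

Definition I_ (m : nat -> nat) (n : nat) (x : vilenkin m) : set (vilenkin m) :=
  cylinder n x.

Definition M_ (m : nat -> nat) (k : nat) : nat := (\prod_(j < k) m j)%N.

(** [mu] is the product of the uniform measures on the ['Z_(m k)]; this
    determines [mu], since the cylinders (with the empty set) are stable under
    intersection and generate the sigma-algebra.  Existence is
    [exists_normalized_haar] below. *)
Definition normalized_haar (R : realType) (m : nat -> nat)
    (mu : {measure set (vilenkin m) -> \bar R}) : Prop :=
  forall n (x : vilenkin m), mu (I_ n x) = (\prod_(k < n) (m k)%:R^-1)%:E.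

(** The measure is the image of the uniform measure on [0, 1] by the expansion
    of reals in the mixed-radix system with bases [m]. *)
Section haar_exists.
Context (R : realType) (m : nat -> nat).
Hypothesis m_ge2 : forall k, (1 < m k)%N.

Let M_gt0 n : (0 < M_ m n)%N.
Proof. by rewrite /M_ prodn_gt0// => i; exact: ltnW. Qed.

Let M_S n : M_ m n.+1 = (M_ m n * m n)%N.
Proof. by rewrite /M_ big_ord_recr. Qed.

Let expansion (t : measurableTypeR R) : vilenkin m :=
  fun k => inZp (Num.truncn (t * (M_ m k.+1)%:R)).

Let level n (t : R) : nat := Num.truncn (t * (M_ m n)%:R).

Let levelS n t : 0 <= t -> (level n.+1 t %/ m n)%N = level n t.
Proof.
move=> t0; rewrite /level.
have tM0 j : 0 <= t * (M_ m j)%:R by rewrite mulr_ge0.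
apply/esym/truncn_def; set q := Num.truncn _.
have mn0 : (0 < m n)%N by exact: ltnW.
have mR0 : 0 < (m n)%:R :> R by rewrite ltr0n.
have /andP[lo hi] := truncn_itv (tM0 n.+1); rewrite -/q in lo hi.
rewrite M_S natrM mulrA in lo hi.
apply/andP; split.
- rewrite -(ler_pM2r mR0) (le_trans _ lo)// -natrM ler_nat.
  by rewrite leq_divM.
- rewrite -(ltr_pM2r mR0) (lt_le_trans hi)// -natrM ler_nat.
  by rewrite ltn_ceil.
Qed.

Let expansion_val t k : (expansion t k : nat) = (level k.+1 t %% m k)%N.
Proof. by rewrite /expansion /= Zp_cast. Qed.

Let cylinder_expansion n (x : vilenkin m) :
  exists N, (N < M_ m n)%N /\ forall t, 0 <= t < 1 ->
    I_ n x (expansion t) <-> level n t = N.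
Proof.
elim: n => [|n [N [NM IH]]].
  exists 0%N; split; first by rewrite M_gt0.
  move=> t /andP[t0 t1]; split=> // _; rewrite /level /M_ big_ord0 mulr1.
  by apply: truncn_def; rewrite t0.
have mn0 : (0 < m n)%N by exact: ltnW.
have xn : (x n < m n)%N by rewrite -[X in (_ < X)%N](Zp_cast (m_ge2 n)).
exists (N * m n + x n)%N; split.
  rewrite M_S (@leq_trans (N.+1 * m n))//; last by rewrite leq_mul2r NM orbT.
  by rewrite mulSn addnC ltn_add2r.
move=> t t01; have t0 : 0 <= t by case/andP: t01.
split=> [tx|tN].
- rewrite (divn_eq (level n.+1 t) (m n)) levelS//; congr (_ * _ + _)%N.
    by apply/IH => // k kn; apply: tx; rewrite ltnW.
  by rewrite -expansion_val tx.
- move=> k; rewrite ltnS leq_eqVlt => /predU1P[->|kn].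
    apply/val_inj; rewrite [LHS]expansion_val tN modnMDl modn_small//.
  have /IH H := t01; apply: H.2 => //.
  by rewrite -levelS// tN divnMDl// divn_small// addn0.
Qed.

Let level_measurable n (B : set nat) : measurable (level n @^-1` B : set (measurableTypeR R)).
Proof.
have nd : nondecreasing_fun (fun t : R => (level n t)%:R : R).
  by move=> s t st; rewrite ler_nat le_truncn// ler_wpM2r.
have -> : level n @^-1` B =
    \bigcup_(j in B) ((fun t : R => (level n t)%:R : R) @^-1` [set j%:R]).
  apply/seteqP; split=> [t Bt|t [j Bj] /= /eqP].
    by exists (level n t).
  by rewrite eqr_nat => /eqP ->.
apply: bigcup_measurable => j _; rewrite -[X in measurable X]setTI.
exact: (nondecreasing_measurable measurableT nd).
Qed.

Let expansion_measurable : measurable_fun setT expansion.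
Proof.
have gE : @measurable _ (vilenkin m) = <<s @cylinders m >> by [].
apply: (measurability _ gE).
move=> _ [_ [n [x ->]] <-]; rewrite setTI.
have -> : expansion @^-1` cylinder n x = \bigcap_(k < n)
    (level k.+1 @^-1` [set l | (l %% m k)%N = x k :> nat]).
  apply/seteqP; split=> t /= tx k /= kn.
    by rewrite -tx// expansion_val.
  by apply: val_inj; rewrite [LHS]expansion_val; exact: tx.
apply: bigcap_measurableType => // k _; exact: level_measurable.
Qed.

HB.instance Definition _ :=
  isMeasurableFun.Build _ _ _ _ expansion expansion_measurable.

Lemma exists_normalized_haar :
  exists mu : probability (vilenkin m) R, normalized_haar mu.
Proof.
exists (distribution (uniform_prob (@ltr01 R)) expansion) => n x.
have mA : measurable (expansion @^-1` I_ n x).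
  rewrite -[X in measurable X]setTI; apply: expansion_measurable => //.
  by apply: sub_sigma_algebra; exists n, x.
rewrite /distribution /pushforward/= /uniform_prob integral_uniform_pdf.
have [N [NM HN]] := cylinder_expansion n x.
have MR0 : 0 < (M_ m n)%:R :> R by rewrite ltr0n.
transitivity (lebesgue_measure (expansion @^-1` I_ n x `&` `[0, 1]%classic)).
  rewrite (eq_integral (fun=> 1%E)); last first.
    move=> t; rewrite inE => -[_] /=; rewrite in_itv/= /uniform_pdf => ->.
    by rewrite subr0 invr1.
  by rewrite integral_cst ?mul1e//; exact: measurableI.
have cE : expansion @^-1` I_ n x `&` `[0, 1[%classic =
    `[N%:R / (M_ m n)%:R, N.+1%:R / (M_ m n)%:R[%classic.
  apply/seteqP; split=> t /=; rewrite !in_itv/=.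
  - move=> [tx t01]; have tN := (HN t t01).1 tx.
    rewrite ler_pdivrMr// ltr_pdivlMr//.
    by rewrite -tN; apply: truncn_itv; rewrite mulr_ge0//; case/andP: t01.
  - rewrite ler_pdivrMr// ltr_pdivlMr// => /andP[lo hi].
    have t0 : 0 <= t by rewrite -(pmulr_lge0 _ MR0) (le_trans _ lo).
    have t1 : t < 1.
      by rewrite -(ltr_pM2r MR0) mul1r (lt_le_trans hi)// ler_nat.
    have t01 : 0 <= t < 1 by rewrite t0.
    split => //; apply/(HN t t01); apply: truncn_def.
    by rewrite lo.
transitivity (lebesgue_measure (expansion @^-1` I_ n x `&` `[0, 1[%classic)).
  have eU : expansion @^-1` I_ n x `&` `[0, 1]%classic =
      (expansion @^-1` I_ n x `&` `[0, 1[) `|`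
      (expansion @^-1` I_ n x `&` [set 1 : R]).
    by rewrite -setIUr setUitv1 ?bnd_simp ?ler01.
  rewrite eU; apply: measureU0; [exact: measurableI|exact: measurableI|].
  apply/eqP; rewrite eq_le measure_ge0 andbT -(lebesgue_measure_set1 (1 : R)).
  by apply: le_measure; rewrite ?inE//; exact: measurableI.
rewrite cE lebesgue_measure_itv/= lte_fin ltr_pM2r ?invr_gt0// ltr_nat ltnSn.
rewrite -EFinB -mulrBl -natrB// subSnn mul1r prodfV; congr ((_^-1)%:E).
by rewrite /M_ natr_prod.
Qed.

End haar_exists.

Definition digit (m : nat -> nat) (n k : nat) : nat := ((n %/ M_ m k) %% m k)%N.

Lemma ltn_M_ (m : nat -> nat) (m_ge2 : forall k, (1 < m k)%N) n : (n < M_ m n)%N.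
Proof.
elim: n => [|n IH]; first by rewrite /M_ big_ord0.
rewrite /M_ big_ord_recr /= -/(M_ m n) (leq_trans _ (leq_mul IH (m_ge2 n)))//.
by rewrite muln2 -addnn addnS ltnS addSn ltnS leq_addr.
Qed.

Lemma digit_expansion (m : nat -> nat) (m_ge2 : forall k, (1 < m k)%N) n :
  n = (\sum_(k < n) digit m n k * M_ m k)%N.
Proof.
have H j : (\sum_(k < j) digit m n k * M_ m k = n %% M_ m j)%N.
  elim: j => [|j IH]; first by rewrite /M_ !big_ord0 modn1.
  have Mj : M_ m j.+1 = (M_ m j * m j)%N by rewrite /M_ big_ord_recr.
  rewrite big_ord_recr /= IH Mj /digit.
  have M0 : (0 < M_ m j)%N by apply: leq_ltn_trans (ltn_M_ m_ge2 j).
  have m0 : (0 < m j)%N by exact: ltnW.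
  have {3}-> : n = (n %/ M_ m j %/ m j * (M_ m j * m j) +
      (n %/ M_ m j %% m j * M_ m j + n %% M_ m j))%N.
    by rewrite addnA (mulnC (M_ m j)) mulnA -mulnDl -!divn_eq.
  rewrite modnMDl [RHS]modn_small 1?addnC//.
  rewrite (@leq_trans ((n %/ M_ m j %% m j).+1 * M_ m j))//.
    by rewrite mulSn ltn_add2r ltn_mod.
  by rewrite [leqRHS]mulnC leq_mul2r ltn_mod m0 orbT.
by rewrite H modn_small// ltn_M_.
Qed.

Lemma digit_eq0 (m : nat -> nat) (m_ge2 : forall k, (1 < m k)%N) n k :
  (n <= k)%N -> digit m n k = 0%N.
Proof.
by move=> nk; rewrite /digit divn_small ?mod0n// (leq_ltn_trans nk)// ltn_M_.
Qed.

Definition rademacher (R : realType) (m : nat -> nat) (k : nat)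
    (x : vilenkin m) : R[i] :=
  let t : R := 2 * pi * (x k : nat)%:R / (m k)%:R in Complex (cos t) (sin t).

(** By [digit_eq0] the product over [k < n] contains all the non-trivial
    factors. *)
Definition psi (R : realType) (m : nat -> nat) (n : nat)
    (x : vilenkin m) : R[i] :=
  \prod_(k < n) rademacher R k x ^+ digit m n k.

Section fourier.
Context (R : realType) (m : nat -> nat) (mu : {measure set (vilenkin m) -> \bar R}).
Implicit Types (f : vilenkin m -> R[i]) (n : nat) (x : vilenkin m).

Definition fourier_coef f n : R[i] :=
  cintegral mu setT (fun x => f x * conjc (psi R n x)).

Definition fourier_sum n f x : R[i] :=
  \sum_(k < n) fourier_coef f k * psi R k x.

Definition log_norm n : R[i] := \sum_(1 <= k < n.+1) k%:R^-1.

Definition norlund_log_mean n f x : R[i] :=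
  (log_norm n)^-1 * \sum_(k < n) fourier_sum k f x / (n - k)%N%:R.

(** [normc] is the real-valued modulus on [R[i]]. *)
Definition weighted_maximal (w : nat -> R) f x : \bar R :=
  ereal_sup [set (Normc.normc (norlund_log_mean n f x) / w n)%:E
            | n in [set n | (0 < n)%N]].

Definition hardy_maximal f x : \bar R :=
  ereal_sup (range (fun n =>
    ((fine (mu (I_ n x)))^-1 * Normc.normc (cintegral mu (I_ n x) f))%:E)).

Definition hardy_norm f : \bar R := norm1 mu (hardy_maximal f).

(** The Hardy space [H_1], its martingales being identified with the functions
    they are the conditional expectations of. *)
Definition hardy_space : set (vilenkin m -> R[i]) :=
  [set f | cintegrable mu setT f /\ (hardy_norm f < +oo)%E].

Definition bounded_H1_L1 (T : (vilenkin m -> R[i]) -> vilenkin m -> \bar R) : Prop :=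
  exists C : R, forall f, hardy_space f ->
    (norm1 mu (T f) <= C%:E * hardy_norm f)%E.

End fourier.

(* Main.v *)
Require Import Defs.
From HB Require Import structures.
From mathcomp Require Import all_boot all_order all_algebra.
From mathcomp Require Import complex zify ring lra.
From mathcomp Require Import all_classical all_reals all_analysis.
From mathcomp Require Import measurable_realfun.

(** a) The Nörlund logarithmic means are averages of the partial sums [S_k f],
    [k < n], and [S_0 f = 0], so the maximal operator is dominated by
    [sup_k |S_k f| / log (k + 1)].  Since [S_k f], [k < M_N], only depends on the
    averages of [f] over the cylinders of level [N], a bound independent of [N]
    for functions on the finite set of these cylinders is enough.  Let
    [lam_i = 2 ^ i * lam_0] with [lam_0] the mean of [f^*], let [nu_i] be the time
    preceding the first exit of the martingale from [|.| <= lam_i], and decompose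
    [f] into its value stopped at [nu_0] and the differences [g] of its values
    stopped at [nu_i] and [nu_{i+1}].  By optional sampling only the points [t]
    with [M_{nu_i(t)} < n] contribute to [S_n g]; there [log n >= c (nu_i(t) + 1)],
    which compensates the sum over [k < nu_i(t)] of the bounds [|D_n| <= C M_k]
    at distance [k].  Hence [g] contributes at most [C lam_i mu{f^* > lam_i}], and
    the sum over [i] is at most [2 C ||f^*||_1].

    b) Take [f = psi_{M_N} D_{M_N}], of Hardy norm at most 1.  On [I_n(0)], [n < N],
    [|L_q f| = M_n (l_{M_n} - 1) / l_q] for [q = M_N + M_n], which is of order
    [M_n n / N]; integrating over the disjoint [I_n(0) \ I_{n+1}(0)] gives a norm
    of order at least [N / phi(M_{N+1})], that is [log M_{N+1} / phi(M_{N+1})]. *)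

Set Implicit Arguments.
Unset Strict Implicit.
Unset Printing Implicit Defensive.

Import Order.TTheory GRing.Theory Num.Theory.
Import numFieldNormedType.Exports.
Import ComplexField.

Local Open Scope classical_set_scope.
Local Open Scope ring_scope.

(** * Stopped martingales on a finite filtered set *)

Section normc_extra.
Context (R : rcfType).
Implicit Types x y : R[i].

Lemma normcE_norm x : (Normc.normc x)%:C%C = `|x|.
Proof. by rewrite normc_def; case: x. Qed.

Lemma normc_ge0 x : 0 <= Normc.normc x.
Proof. by case: x => a b; exact: sqrtr_ge0. Qed.

Lemma normcB x y : Normc.normc (x - y) <= Normc.normc x + Normc.normc y.
Proof. by rewrite -lecR rmorphD /= !normcE_norm ler_normB. Qed.

Lemma normc_sum (I : Type) (r : seq I) (P : pred I) (F : I -> R[i]) :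
  Normc.normc (\sum_(i <- r | P i) F i) <= \sum_(i <- r | P i) Normc.normc (F i).
Proof.
elim/big_ind2 : _ => [|x a y b xa yb|//]; first by rewrite Normc.normc0.
exact: le_trans (le_normcD _ _) (lerD xa yb).
Qed.

Lemma normc_real (a : R) : Normc.normc a%:C%C = `|a|.
Proof. by rewrite /Normc.normc/= expr0n/= addr0 sqrtr_sqr. Qed.

Lemma normc_nat n : Normc.normc (n%:R : R[i]) = n%:R.
Proof. by rewrite -(rmorph_nat (real_complex R)) normc_real normr_nat. Qed.

Lemma normc_conj x : Normc.normc (conjc x) = Normc.normc x.
Proof. by case: x => a b; rewrite /Normc.normc/= sqrrN. Qed.

Lemma normc_prod (I : Type) (r : seq I) (P : pred I) (F : I -> R[i]) :
  Normc.normc (\prod_(i <- r | P i) F i) = \prod_(i <- r | P i) Normc.normc (F i).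
Proof.
exact: (big_morph (@Normc.normc R) (@Normc.normcM R) (@Normc.normc1 R)).
Qed.

Lemma normcX x n : Normc.normc (x ^+ n) = Normc.normc x ^+ n.
Proof. by elim: n => [|n IH]; rewrite ?Normc.normc1// !exprS Normc.normcM IH. Qed.

End normc_extra.

(** The terms below [F] form a progression of ratio 2, whose sum is at most twice its last term. *)
Lemma sum_geometric_lt_le2 (R : realDomainType) (a F : R) n :
  0 <= a -> 0 <= F ->
  \sum_(i < n) (a * 2 ^+ i) * (a * 2 ^+ i < F)%R%:R <= 2 * F.
Proof.
move=> a0 F0.
have H k : \sum_(i < k) (a * 2 ^+ i) * (a * 2 ^+ i < F)%R%:R <= a * 2 ^+ k.
  elim: k => [|k IH]; first by rewrite big_ord0 expr0 mulr1.
  rewrite big_ord_recr/=; set b := a * 2 ^+ k in IH *.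
  have b0 : 0 <= b by rewrite mulr_ge0 ?exprn_ge0.
  have -> : a * 2 ^+ k.+1 = b + b by rewrite exprS /b; ring.
  by rewrite lerD// -[leRHS]mulr1 ler_wpM2l//; case: (_ < _).
elim: n => [|n IH]; first by rewrite big_ord0 mulr_ge0.
rewrite big_ord_recr/=; case: (ltP (a * 2 ^+ n) F) => [aF|_].
  by have := H n; rewrite mulr1; lra.
by rewrite mulr0 addr0.
Qed.

(** * Averages and stopping times for a refining sequence of partitions *)

Section filtration.
Context (T : finType) (e : nat -> rel T).
Hypothesis e_refl : forall n, reflexive (e n).
Hypothesis e_sym : forall n, symmetric (e n).
Hypothesis e_trans : forall n, transitive (e n).
Hypothesis e_le : forall i j x y, (i <= j)%N -> e j x y -> e i x y.

(** The conditional expectation given the classes of [e n], for the uniform measure on [T]. The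
    field is left open since both complex functions and real indicators are averaged. *)
Definition cond_mean (F : fieldType) n (f : T -> F) x : F :=
  (\sum_(y | e n x y) f y) / #|[pred y | e n x y]|%:R.

Lemma eq_class n x y : e n x y -> e n x =1 e n y.
Proof.
move=> xy z; apply/idP/idP; last exact: e_trans xy.
by move=> xz; apply: e_trans xz; rewrite e_sym.
Qed.

Lemma card_class_gt0 n x : (0 < #|[pred y | e n x y]|)%N.
Proof. by apply/card_gt0P; exists x; rewrite inE e_refl. Qed.

Lemma cond_mean_class (F : fieldType) n (f : T -> F) x y :
  e n x y -> cond_mean n f x = cond_mean n f y.
Proof.
by move=> xy; rewrite /cond_mean (eq_bigl _ _ (eq_class xy)) (eq_card (eq_class xy)).
Qed.

(** Equivalently, each set where [nu] equals [n] is a union of classes of [e n]. *)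
Definition stopping_time (nu : T -> nat) := forall x y, e (nu x) x y -> nu y = nu x.

(** The stopped classes partition [T] and [h] is constant on each of them; after exchanging the
    summations, each [h y * f y] is divided by the size of its class and counted that many times. *)
Lemma optional_sampling (F : numFieldType) (nu : T -> nat) (h f : T -> F) :
  stopping_time nu -> (forall x y, e (nu x) x y -> h y = h x) ->
  \sum_x h x * cond_mean (nu x) f x = \sum_x h x * f x.
Proof.
move=> nuP hP.
pose c x : F := #|[pred y | e (nu x) x y]|%:R.
have sw x y : e (nu x) x y = e (nu y) y x.
  by apply/idP/idP => xy; have := xy; rewrite -(nuP _ _ xy) e_sym.
transitivity (\sum_x \sum_(y | e (nu x) x y) h x * f y / c x).
  apply: eq_bigr => x _; rewrite /cond_mean mulrA mulr_sumr mulr_suml.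
  by [].
rewrite (exchange_big_dep xpredT)//=; apply: eq_bigr => y _.
transitivity (\sum_(x | e (nu y) y x) h y * f y / c y).
  rewrite (eq_bigl _ _ (fun x => sw x y)); apply: eq_bigr => x yx.
  rewrite (hP _ _ yx) /c (nuP _ _ yx); congr (_ / _%:R).
  by apply: eq_card => z; rewrite !inE; apply/esym/eq_class.
rewrite sumr_const -[_ *+ _]mulr_natr divfK//.
by rewrite pnatr_eq0 -lt0n card_class_gt0.
Qed.

(** * Times just before the martingale leaves a disc *)

Section stopping.
Context (R : rcfType) (N : nat) (f : T -> R[i]).

Let A n x := Normc.normc (cond_mean n f x).

(* One stops just before leaving [A <= lam], for any point of the class: the
   stopped function is then bounded by [lam]. *)
Let stop lam x n := (n == N) || [exists y, e n x y && (lam < A n.+1 y)].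

Let stopN lam x : exists n, stop lam x n.
Proof. by exists N; rewrite /stop eqxx. Qed.

Definition first_exit lam x := ex_minn (stopN lam x).

Lemma first_exit_le lam x : (first_exit lam x <= N)%N.
Proof.
by rewrite /first_exit; case: ex_minnP => n _; apply; rewrite /stop eqxx.
Qed.

Let stop_class lam n x y : e n x y -> stop lam x n = stop lam y n.
Proof.
by move=> xy; rewrite /stop; congr orb; apply: eq_existsb => z; rewrite (eq_class xy).
Qed.

(** Stopping at level [n] depends on the class of level [n] only, and points equivalent at some
    level are so at all earlier ones. *)
Lemma first_exit_stopping lam : stopping_time (first_exit lam).
Proof.
move=> x y; rewrite /first_exit.
case: ex_minnP => n nx nmin; case: ex_minnP => k ky kmin xy.
have kn : (k <= n)%N by apply: kmin; rewrite -(stop_class _ xy).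
apply/eqP; rewrite eqn_leq kn /=; apply: nmin.
by rewrite (stop_class lam (e_le kn xy)).
Qed.

(** Were the value at level [n.+1] above [lam], [x] itself would be a witness for stopping at level
    [n]. Level 0 has no predecessor, hence the hypothesis. *)
Lemma cond_mean_first_exit lam x :
  A 0 x <= lam -> A (first_exit lam x) x <= lam.
Proof.
move=> A0; rewrite /first_exit; case: ex_minnP => -[//|n] _ nmin.
rewrite leNgt; apply/negP => An.
have /nmin : stop lam x n.
  by rewrite /stop; apply/orP; right; apply/existsP; exists x; rewrite e_refl.
by rewrite ltnn.
Qed.

Lemma first_exit_homo lam lam' x :
  lam <= lam' -> (first_exit lam x <= first_exit lam' x)%N.
Proof.
move=> ll; rewrite {2}/first_exit; case: ex_minnP => n nx _.
rewrite /first_exit; case: ex_minnP => k _; apply.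
case/orP: nx => [nN|/existsP[y /andP[xy Ay]]]; first by rewrite /stop nN.
by apply/orP; right; apply/existsP; exists y; rewrite xy (le_lt_trans ll).
Qed.

Lemma first_exitP lam x : (first_exit lam x < N)%N ->
  exists2 y, e (first_exit lam x) x y & lam < A (first_exit lam x).+1 y.
Proof.
rewrite /first_exit; case: ex_minnP => n /orP[/eqP->|]; first by rewrite ltnn.
by case/existsP => y /andP[xy Ay] _ _; exists y.
Qed.

End stopping.

(** * Size of the exit sets and the maximal inequality for kernels *)

Section maximal.
Context (R : rcfType) (N B : nat) (M : nat -> nat).
(** Up to level [N], classes of level [n] have relative size [1 / M n]; by [M_bnd] a child then
    fills at least [1 / B] of its parent. *)
Hypothesis card_class : forall n x, (n <= N)%N -> (#|[pred y | e n x y]| * M n = #|T|)%N.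
Hypothesis eN : forall x y, e N x y -> x = y.
Hypothesis M0 : M 0 = 1%N.
Hypothesis M_gt0 : forall n, (0 < M n)%N.
Hypothesis M_le : forall n, (M n <= M n.+1)%N.
Hypothesis M_bnd : forall n, (M n.+1 <= B * M n)%N.

Lemma class0 x y : e 0 x y.
Proof.
have := card_class x (leq0n N); rewrite M0 muln1 => /eqP H.
by have /(_ y) := (subset_cardP (eqP H)) (subset_predT _); rewrite !inE.
Qed.

Let cT : R := #|T|%:R.

Let M_mono i j : (i <= j)%N -> (M i <= M j)%N.
Proof. exact: homo_leq (leqnn) leq_trans M_le i j. Qed.

Let cT_gt0 (x : T) : 0 < cT.
Proof. by rewrite ltr0n; apply/card_gt0P; exists x. Qed.

Let sum_class n x : (n <= N)%N -> \sum_y (M n)%:R * (e n x y)%:R = cT.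
Proof.
move=> nN; rewrite -mulr_sumr -natr_sum -natrM /cT -(card_class x nN) mulnC.
by rewrite -sum1_card [in RHS]big_mkcond/=.
Qed.

Let sum_class' n y : (n <= N)%N -> \sum_x (M n)%:R * (e n x y)%:R = cT.
Proof. by move=> nN; rewrite -(sum_class y nN); apply: eq_bigr => x _; rewrite e_sym. Qed.

(** In the application, the sum of the kernels D_{M_k}(x - t), k < j, each of mean 1 in either
    variable. *)
Definition prefix_weight j x t : R := \sum_(k < j) (M k)%:R * (e k x t)%:R.

Lemma prefix_weight_ge0 j x t : 0 <= prefix_weight j x t.
Proof. by apply: sumr_ge0 => k _; rewrite mulr_ge0. Qed.

(** The class of a point exiting before [N] has a child on which [Fs] exceeds [lam], filling at
    least [1 / B] of it. So the indicator of exit is at most [B] times the stopped average of the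
    indicator of [lam < Fs], and optional sampling removes the average. *)
Lemma exit_set_card (f : T -> R[i]) (Fs : T -> R) lam :
  (forall n x, (n <= N)%N -> Normc.normc (cond_mean n f x) <= Fs x) ->
  \sum_x (first_exit N f lam x < N)%:R <= B%:R * \sum_x (lam < Fs x)%R%:R :> R.
Proof.
move=> fFs; set nu := first_exit N f lam.
pose h x : R := (nu x < N)%:R; pose k x : R := (lam < Fs x)%R%:R.
have nuP : stopping_time nu by exact: first_exit_stopping.
apply: (@le_trans _ _ (B%:R * \sum_x h x * cond_mean (nu x) k x)); last first.
  rewrite optional_sampling//; last by move=> x y /nuP; rewrite /h => ->.
  rewrite ler_wpM2l// ler_sum// => x _; rewrite -[leRHS]mul1r ler_wpM2r ?ler0n//.
  by rewrite /h lern1; case: (_ < _)%N.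
rewrite mulr_sumr; apply: ler_sum => x _; rewrite /h.
case: ltnP => [nuN|_]; last by rewrite mul0r mulr0.
rewrite mul1r /cond_mean mulrA ler_pdivlMr; last by rewrite ltr0n card_class_gt0.
have [y xy Ay] := first_exitP nuN; rewrite -/nu in xy Ay.
rewrite mul1r (@le_trans _ _ (B%:R * #|[pred z | e (nu x).+1 y z]|%:R))//.
  rewrite -natrM ler_nat -(leq_pmul2r (M_gt0 (nu x).+1)) -mulnA card_class//.
  by rewrite -(card_class x (ltnW nuN)) mulnCA leq_mul2l M_bnd orbT.
rewrite ler_wpM2l// -sum1_card natr_sum big_mkcond [leRHS]big_mkcond /=.
apply: ler_sum => z _; rewrite inE; case: ifPn => [yz|_]; last first.
  by case: ifP => // _; rewrite /k ler0n.
have xz : e (nu x) x z by apply: e_trans xy _; exact: e_le yz.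
rewrite xz /k (lt_le_trans Ay)// (cond_mean_class _ yz); exact: fFs.
Qed.

Section kernel.
Context (K : nat -> T -> T -> R[i]) (w : nat -> R).
(** What is used of the Dirichlet kernels D_n(x - t): the trivial bound, the bound at separated
    points, and constancy in [t] on cylinders. The weight [w] grows at least logarithmically. *)
Hypothesis K_le : forall n x t, Normc.normc (K n x t) <= n%:R.
Hypothesis K_sep : forall n k x t, ~~ e k.+1 x t -> Normc.normc (K n x t) <= (M k.+1)%:R.
Hypothesis K_class : forall n j x t t', (n <= M j)%N -> e j t t' -> K n x t = K n x t'.
Hypothesis w_ge : forall n j, (0 < n)%N -> (M j <= n)%N -> j.+1%:R <= w n.

Definition integral_op n (f : T -> R[i]) x : R[i] := (\sum_t f t * K n x t) / #|T|%:R.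

(** If [x] and [t] separate between levels [k] and [k.+1], with [k < j], the kernel is at most
    [M k.+1 <= B * M k], and [M k] is a term of the weight. *)
Lemma kernel_prefix n j x t : ~~ e j x t ->
  Normc.normc (K n x t) <= B%:R * prefix_weight j x t.
Proof.
elim: j => [|j IH]; first by rewrite class0.
move=> xt; rewrite /prefix_weight big_ord_recr/= -/(prefix_weight j x t) mulrDr.
case: (boolP (e j x t)) => [_|/IH H].
  rewrite (le_trans (K_sep n xt))// ler_wpDl ?mulr_ge0 ?prefix_weight_ge0//.
  by rewrite mulr1 -natrM ler_nat M_bnd.
by rewrite mulr0 mulr0 addr0.
Qed.

(** A logarithmic bound on the Lebesgue constants. Let [M j <= n < M j.+1]: relative to [cT], each
    of the [j.+1] levels [k <= j] contributes at most [B], and the class of level [j.+1] at most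
    1. *)
Lemma kernel_L1 n x : (0 < n < M N)%N ->
  \sum_t Normc.normc (K n x t) <= B.+1%:R * w n * cT.
Proof.
case/andP=> n0 nM.
have ex : exists j, (M j <= n)%N by exists 0%N; rewrite M0.
have bnd j : (M j <= n)%N -> (j <= N)%N.
  by move=> Mj; rewrite leqNgt; apply/negP => /ltnW/M_mono; rewrite leqNgt (leq_ltn_trans Mj).
case: (ex_maxnP ex bnd) => j Mj jmax.
have jN : (j < N)%N.
  rewrite ltn_neqAle bnd// andbT; apply/eqP => jN; move: Mj; rewrite jN.
  by rewrite leqNgt nM.
have nj : (n < M j.+1)%N by rewrite ltnNge; apply/negP => /jmax; rewrite ltnn.
apply: (@le_trans _ _ (\sum_t (B%:R * prefix_weight j.+1 x t +
    (M j.+1)%:R * (e j.+1 x t)%:R))).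
  apply: ler_sum => t _; case: (boolP (e j.+1 x t)) => xt.
    rewrite mulr1 ler_wpDl ?mulr_ge0 ?prefix_weight_ge0// (le_trans (K_le _ _ _))//.
    by rewrite ler_nat ltnW.
  by rewrite mulr0 addr0 kernel_prefix.
rewrite big_split/= sum_class// -mulr_sumr exchange_big/=.
rewrite (eq_bigr (fun=> cT)) => [|k _]; last by rewrite sum_class// (leq_trans _ jN)// ltnW.
rewrite sumr_const card_ord -[cT *+ _]mulr_natl mulrA -[X in _ + X]mul1r -mulrDl.
rewrite ler_wpM2r ?ler0n// (le_trans _ (ler_wpM2l (ler0n _ _) (w_ge n0 Mj)))//.
by rewrite -!natrM natr1 ler_nat; lia.
Qed.

Lemma sum_prefix_weight j t : (j <= N)%N -> \sum_x prefix_weight j x t = j%:R * cT.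
Proof.
move=> jN; rewrite exchange_big/= (eq_bigr (fun=> cT)) => [|k _].
  by rewrite sumr_const card_ord mulr_natl.
by rewrite sum_class'// (leq_trans _ jN)// ltnW.
Qed.

(* The first term bounds the contribution to the maximal function at [x] of the
   stopped class of [x], the second one that of the other classes. *)
Definition exit_majorant (nu : T -> nat) x : R :=
  B.+1%:R * (nu x < N)%:R +
  (\sum_t (nu t < N)%:R * (B%:R * prefix_weight (nu t) x t / (nu t).+1%:R)) / cT.

(** The mean of [prefix_weight (nu t)] is [nu t], which the denominator absorbs; the second term
    thus adds [B] to the [B.+1] of the first. *)
Lemma sum_exit_majorant (nu : T -> nat) : (forall x, (nu x <= N)%N) ->
  \sum_x exit_majorant nu x <= (2 * B%:R + 1) * \sum_x (nu x < N)%:R.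
Proof.
move=> nuN.
pose q t x : R := (nu t < N)%:R * (B%:R * prefix_weight (nu t) x t / (nu t).+1%:R).
have H : \sum_x (\sum_t q t x) / cT <= B%:R * \sum_t (nu t < N)%:R.
  rewrite -mulr_suml exchange_big/= mulr_suml mulr_sumr.
  apply: ler_sum => t _; have c0 := cT_gt0 t.
  rewrite -mulr_sumr -mulr_suml -mulr_sumr sum_prefix_weight// mulrC.
  rewrite mulrCA [leRHS]mulrC ler_wpM2l// mulrC ler_pdivrMr// ler_pdivrMr ?ltr0n//.
  by rewrite -mulrA ler_wpM2l// mulrC ler_wpM2l ?ler_nat// ltW.
rewrite /exit_majorant big_split/= -mulr_sumr; move: H; rewrite -natr1.
set X := \sum_x _ / cT; set S := \sum_t _; lra.
Qed.

(** Only points [t] with [nu t < N] and [M (nu t) < n] contribute. Those whose stopped class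
    contains [x] are controlled by [kernel_L1], the others by [kernel_prefix]. *)
Lemma integral_op_stopped_difference (nu nu' : T -> nat) (f : T -> R[i]) c n x :
  stopping_time nu -> stopping_time nu' ->
  (forall x, (nu x <= nu' x)%N) -> (forall x, (nu' x <= N)%N) ->
  (forall x, Normc.normc (cond_mean (nu' x) f x - cond_mean (nu x) f x) <= c) ->
  (0 < n < M N)%N ->
  Normc.normc (integral_op n (fun t => cond_mean (nu' t) f t - cond_mean (nu t) f t) x)
    <= w n * (c * exit_majorant nu x).
Proof.
move=> nuP nuP' nu_le nuN gc nM; set g := fun t => _.
have [n0 _] := andP nM.
have w0 : 0 <= w n by rewrite (le_trans ler01)// (w_ge (j := 0))// M0.
have c0 : 0 <= c by apply: le_trans (gc x); exact: normc_ge0.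
(* Where [n <= M (nu t)] the kernel is constant on the stopped classes, so that
   both stopped functions have there the same integral against it as [f]. *)
pose k t := if (n <= M (nu t))%N then K n x t else 0.
have k_nu y z : e (nu y) y z -> k z = k y.
  by move=> yz; rewrite /k (nuP _ _ yz); case: ifP => // nMy; rewrite (K_class x nMy yz).
have gk0 : \sum_t g t * k t = 0.
  rewrite (eq_bigr (fun t => k t * cond_mean (nu' t) f t - k t * cond_mean (nu t) f t)).
    by rewrite sumrB !optional_sampling ?subrr// => y z yz; apply: k_nu; exact: e_le yz.
  by move=> t _; rewrite mulrC mulrBr.
pose h t := if (n <= M (nu t))%N then 0 else K n x t.
have -> : integral_op n g x = (\sum_t g t * h t) / #|T|%:R.
  rewrite /integral_op; congr (_ / _).
  transitivity (\sum_t g t * h t + \sum_t g t * k t); last by rewrite gk0 addr0.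
  rewrite -big_split/=; apply: eq_bigr => t _; rewrite -mulrDr /h /k.
  by case: ifP; rewrite ?add0r ?addr0.
rewrite Normc.normcM Normc.normcV normc_nat -/cT ler_pdivrMr ?(cT_gt0 x)//.
apply: (le_trans (normc_sum _ _ _)).
pose q t : R := (nu t < N)%:R * (B%:R * prefix_weight (nu t) x t / (nu t).+1%:R).
have q0 t : 0 <= q t by rewrite !mulr_ge0 ?prefix_weight_ge0 ?invr_ge0.
apply: (@le_trans _ _ (\sum_t c * ((nu x < N)%:R * Normc.normc (K n x t) + w n * q t))).
  apply: ler_sum => t _; rewrite Normc.normcM.
  have rhs0 : 0 <= c * ((nu x < N)%:R * Normc.normc (K n x t) + w n * q t).
    by rewrite mulr_ge0//; apply: addr_ge0; apply: mulr_ge0 => //; exact: normc_ge0.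
  case: (ltnP (nu t) N) => [tN|Nt]; last first.
    have nt : nu t = N by apply/eqP; rewrite eqn_leq Nt (leq_trans (nu_le t)).
    have nt' : nu' t = N by apply/eqP; rewrite eqn_leq nuN -{1}nt nu_le.
    by rewrite /g/= nt; rewrite nt' subrr Normc.normc0 mul0r.
  rewrite ler_pM ?normc_ge0// ?gc// /h.
  case: ifPn => [_|]; last rewrite -ltnNge => Mn.
    by rewrite Normc.normc0; apply: addr_ge0; apply: mulr_ge0 => //; exact: normc_ge0.
  case: (boolP (e (nu t) t x)) => tx.
    by rewrite (nuP _ _ tx) tN mul1r lerDl mulr_ge0.
  rewrite ler_wpDl ?mulr_ge0 ?normc_ge0//.
  rewrite (@le_trans _ _ (B%:R * prefix_weight (nu t) x t)) ?kernel_prefix//.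
    by rewrite e_sym.
  (* As [M (nu t) < n], [w_ge] shows that [w n / (nu t).+1] is at least 1. *)
  rewrite /q tN mul1r mulrA ler_pdivlMr ?ltr0n// mulrC.
  by rewrite ler_wpM2r ?mulr_ge0 ?prefix_weight_ge0// w_ge// ltnW.
have -> : w n * (c * exit_majorant nu x) * cT = c * (w n * (exit_majorant nu x * cT)).
  by ring.
rewrite -mulr_sumr ler_wpM2l// big_split/= -!mulr_sumr /exit_majorant.
rewrite mulrDl divfK ?gt_eqF ?(cT_gt0 x)// mulrDr lerD2r.
rewrite (le_trans (ler_wpM2l _ (kernel_L1 x nM)))//.
by rewrite le_eqVlt; apply/orP; left; apply/eqP; ring.
Qed.

(** One majorant [G] serves all [n]. In the constant, [B.+1] comes from the part stopped at [nu 0];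
    for the differences, 3 comes from [lam i + lam i.+1], [2 * B + 1] from [sum_exit_majorant], [B]
    from [exit_set_card] and 2 from the geometric sum. *)
Lemma sublinear_maximal_inequality (f : T -> R[i]) (Fs : T -> R) :
  (forall n x, (n <= N)%N -> Normc.normc (cond_mean n f x) <= Fs x) ->
  exists2 G : T -> R,
    forall n x, (0 < n < M N)%N -> Normc.normc (integral_op n f x) <= w n * G x &
    \sum_x G x <= (B.+1%:R + 6 * B%:R * (2 * B%:R + 1)) * \sum_x Fs x.
Proof.
(* Level 0 has a single class, so the mean of [Fs] bounds the initial value of the martingale. *)
move=> fFs; pose lam i : R := (\sum_x Fs x) / cT * 2 ^+ i.
have Fs0 x : 0 <= Fs x by apply: le_trans (fFs 0%N x _) => //; exact: normc_ge0.
have SFs0 : 0 <= \sum_x Fs x by apply: sumr_ge0.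
have lam0 i : 0 <= lam i by rewrite !mulr_ge0 ?invr_ge0 ?exprn_ge0// ler0n.
have A0 x i : Normc.normc (cond_mean 0 f x) <= lam i.
  apply: (@le_trans _ _ (lam 0%N)); last first.
    by rewrite ler_wpM2l ?exprn_ege1 ?ler1n// mulr_ge0 ?invr_ge0// ler0n.
  rewrite /lam expr0 mulr1 ler_pdivlMr ?(cT_gt0 x)// mulrC -/cT.
  rewrite mulr_natl -sumr_const; apply: ler_sum => y _.
  by rewrite (cond_mean_class f (class0 x y)) fFs.
(* As [#|T| <= 2 ^ #|T|], after [#|T|] doublings no value of [Fs] exceeds the level, and the exit
   time is [N] everywhere. *)
have Flam x : Fs x <= lam #|T|.
  apply: (@le_trans _ _ (\sum_y Fs y)).
    by rewrite (bigD1 x)//= lerDl sumr_ge0.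
  rewrite /lam mulrAC ler_pdivlMr ?(cT_gt0 x)// ler_wpM2l// -natrX ler_nat.
  by rewrite ltnW// ltn_expl.
pose nu i := first_exit N f (lam i).
have nuP i : stopping_time (nu i) by exact: first_exit_stopping.
have nuN i x : (nu i x <= N)%N by exact: first_exit_le.
have nuS i x : (nu i x <= nu i.+1 x)%N.
  apply: first_exit_homo; rewrite ler_wpM2l ?mulr_ge0 ?invr_ge0 ?ler0n//.
  by rewrite ler_weXn2l ?ler1n.
have nuA i x : Normc.normc (cond_mean (nu i x) f x) <= lam i by exact: cond_mean_first_exit.
have nuI x : nu #|T| x = N.
  apply/eqP; rewrite eqn_leq nuN leqNgt; apply/negP => xN.
  by have [y _] := first_exitP xN; rewrite ltNge (le_trans (fFs _ _ xN) (Flam y)).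
have fN x : cond_mean N f x = f x.
  rewrite /cond_mean (eq_bigl (pred1 x)); last first.
    by move=> y; apply/idP/eqP => [/eN//|->]; rewrite e_refl.
  rewrite big_pred1_eq (@fintype.eq_card1 _ x) ?divr1// => y; rewrite !inE.
  by apply/idP/eqP => [/eN//|->]; rewrite e_refl.
pose g i t := cond_mean (nu i.+1 t) f t - cond_mean (nu i t) f t.
have g3 i x : Normc.normc (g i x) <= 3 * lam i.
  rewrite (le_trans (normcB _ _))//.
  rewrite (le_trans (lerD (nuA _ _) (nuA _ _)))// /lam exprS; lra.
have dec x : f x = cond_mean (nu 0%N x) f x + \sum_(i < #|T|) g i x.
  rewrite -[LHS]fN -[in LHS](nuI x) -(big_mkord xpredT (fun i => g i x)).
  by rewrite (telescope_sumr (fun i => cond_mean (nu i x) f x))// addrC subrK.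
exists (fun x => B.+1%:R * lam 0%N + \sum_(i < #|T|) 3 * lam i * exit_majorant (nu i) x).
  move=> n x nM.
  have -> : integral_op n f x = integral_op n (fun t => cond_mean (nu 0%N t) f t) x +
      \sum_(i < #|T|) integral_op n (g i) x.
    rewrite /integral_op -mulr_suml -mulrDl; congr (_ / _).
    rewrite exchange_big/= -big_split/=; apply: eq_bigr => t _.
    by rewrite -mulr_suml -mulrDl -dec.
  rewrite mulrDr (le_trans (le_normcD _ _))// lerD//.
    rewrite Normc.normcM Normc.normcV normc_nat -/cT ler_pdivrMr ?(cT_gt0 x)//.
    rewrite (le_trans (normc_sum _ _ _))//.
    apply: (@le_trans _ _ (lam 0%N * \sum_t Normc.normc (K n x t))).
      rewrite mulr_sumr; apply: ler_sum => t _; rewrite Normc.normcM.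
      by rewrite ler_wpM2r ?normc_ge0.
    rewrite (le_trans (ler_wpM2l _ (kernel_L1 x nM)))//.
    by rewrite le_eqVlt; apply/orP; left; apply/eqP; ring.
  rewrite (le_trans (normc_sum _ _ _))// mulr_sumr; apply: ler_sum => i _.
  exact: (integral_op_stopped_difference x (nuP i) (nuP i.+1) (nuS i) (nuN i.+1) (g3 i) nM).
rewrite big_split/= sumr_const -[_ *+ _]mulr_natl -/cT mulrDl lerD//.
  have [x _|T0] := pickP (pred_of_simpl (pred_of_argType T)); last first.
    by rewrite /cT (fintype.eq_card0 T0) mul0r mulr_ge0.
  by rewrite /lam expr0 mulr1 mulrCA [cT * _]mulrC divfK// gt_eqF// (cT_gt0 x).
rewrite exchange_big/=.
apply: (@le_trans _ _ (\sum_(i < #|T|)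
    3 * lam i * ((2 * B%:R + 1) * (B%:R * \sum_x (lam i < Fs x)%R%:R)))).
  apply: ler_sum => i _; rewrite -mulr_sumr.
  have l3 : 0 <= 3 * lam i by apply: mulr_ge0.
  rewrite ler_wpM2l//.
  rewrite (le_trans (sum_exit_majorant (nuN i)))//.
  rewrite ler_wpM2l ?addr_ge0 ?mulr_ge0 ?ler0n//; exact: exit_set_card.
rewrite (eq_bigr (fun i : 'I_#|T| => 3 * B%:R * (2 * B%:R + 1) *
    \sum_x lam i * (lam i < Fs x)%R%:R)); last first.
  by move=> i _; rewrite -mulr_sumr; ring.
rewrite -mulr_sumr exchange_big/=.
have -> : 6 * B%:R * (2 * B%:R + 1) = 3 * B%:R * (2 * B%:R + 1) * 2 :> R by ring.
rewrite -[leRHS]mulrA ler_wpM2l ?mulr_ge0 ?addr_ge0 ?mulr_ge0 ?ler0n//.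
rewrite mulr_sumr; apply: ler_sum => x _; apply: sum_geometric_lt_le2 => //.
by rewrite mulr_ge0 ?invr_ge0 ?ler0n.
Qed.

End kernel.
End maximal.
End filtration.

(** * Vilenkin functions and Dirichlet kernels *)

Section mixed_radix.
Context (m : nat -> nat).
Hypothesis m_ge2 : forall k, (1 < m k)%N.

Lemma M_S n : M_ m n.+1 = (M_ m n * m n)%N.
Proof. by rewrite /M_ big_ord_recr. Qed.

Lemma M_0 : M_ m 0 = 1%N. Proof. by rewrite /M_ big_ord0. Qed.

Lemma M_gt0 n : (0 < M_ m n)%N.
Proof. exact: leq_ltn_trans (ltn_M_ m_ge2 n). Qed.

Lemma dvdn_M k n : (k <= n)%N -> (M_ m k %| M_ m n)%N.
Proof.
elim: n => [|n IH]; first by rewrite leqn0 => /eqP->.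
rewrite leq_eqVlt => /predU1P[->//|]; rewrite ltnS => /IH kn.
by rewrite M_S dvdn_mulr.
Qed.

Lemma leq_M k n : (k <= n)%N -> (M_ m k <= M_ m n)%N.
Proof. by move=> kn; rewrite dvdn_leq ?M_gt0 ?dvdn_M. Qed.

Lemma digit_sum n j : (\sum_(k < j) digit m n k * M_ m k = n %% M_ m j)%N.
Proof.
elim: j => [|j IH]; first by rewrite M_0 big_ord0 modn1.
rewrite big_ord_recr/= IH M_S /digit.
have d0 : (0 < M_ m j)%N by exact: M_gt0.
rewrite [in RHS](divn_eq n (M_ m j)) [in RHS](divn_eq (n %/ M_ m j) (m j)).
rewrite mulnDl -mulnA (mulnC (m j)) -addnA modnMDl [RHS]modn_small; first exact: addnC.
rewrite (@leq_trans ((n %/ M_ m j %% m j).+1 * M_ m j))//.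
  by rewrite mulSn addnC ltn_add2r ltn_mod.
by rewrite mulnC leq_mul2l ltn_mod (ltnW (m_ge2 j)) orbT.
Qed.

Lemma digit_lt n k : (digit m n k < m k)%N.
Proof. by rewrite ltn_mod ltnW. Qed.

Lemma digitMD_small n q i k : (k < n)%N -> digit m (q * M_ m n + i) k = digit m i k.
Proof.
move=> kn; have /dvdnP[c nE] := dvdn_M kn.
rewrite /digit nE M_S mulnA [(_ * (M_ m k * _))%N]mulnCA -mulnA (mulnC (M_ m k)).
by rewrite divnMDl ?M_gt0// mulnA modnMDl.
Qed.

Lemma digitM_small n q k : (k < n)%N -> digit m (q * M_ m n) k = 0%N.
Proof. by move=> kn; rewrite -[(q * _)%N]addn0 digitMD_small// /digit div0n mod0n. Qed.

Lemma digit_ge i n k : (i < M_ m n)%N -> (n <= k)%N -> digit m i k = 0%N.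
Proof.
by move=> iM nk; rewrite /digit divn_small ?mod0n// (leq_trans iM)// leq_M.
Qed.

Lemma digitMD_large n q i k : (i < M_ m n)%N -> (n <= k)%N ->
  digit m (q * M_ m n + i) k = digit m (q * M_ m n) k.
Proof.
move=> iM nk; have /dvdnP[c nE] := dvdn_M nk.
rewrite /digit nE (mulnC c) !divnMA divnMDl ?M_gt0// (divn_small iM) addn0.
by rewrite mulnK ?M_gt0.
Qed.

(** No carry occurs: [i] has digits below position [n] only, the multiple of [M_ m n] from [n] on
    only. *)
Lemma digitMD n q i k : (i < M_ m n)%N ->
  digit m (q * M_ m n + i) k = (digit m (q * M_ m n) k + digit m i k)%N.
Proof.
move=> iM; case: (leqP n k) => [nk|kn].
  by rewrite digitMD_large// (digit_ge iM nk) addn0.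
by rewrite digitMD_small// digitM_small.
Qed.

(** For [a < M_ m N] these points represent each cylinder of level [N] once. *)
Definition pt (a : nat) : vilenkin m := fun k => inZp (digit m a k).

Lemma pt_val a k : pt a k = digit m a k :> nat.
Proof. by rewrite /= Zp_cast// modn_small// digit_lt. Qed.

Lemma vilenkin_lt (x : vilenkin m) k : (x k < m k)%N.
Proof. by have := ltn_ord (x k); rewrite [X in (_ < X)%N -> _]Zp_cast. Qed.

Lemma I_pt n a b : I_ n (pt a) (pt b) <-> a = b %[mod M_ m n].
Proof.
split=> [ab|ab k kn].
  by rewrite -!digit_sum; apply: eq_bigr => k _; rewrite -!pt_val ab.
apply: val_inj; rewrite [LHS]pt_val [RHS]pt_val.
rewrite (divn_eq a (M_ m n)) (divn_eq b (M_ m n)) ab.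
by rewrite !digitMD_small.
Qed.

Lemma I_refl n (x : vilenkin m) : I_ n x x. Proof. by []. Qed.

Lemma I_sym n (x y : vilenkin m) : I_ n x y -> I_ n y x.
Proof. by move=> xy k kn; rewrite xy. Qed.

Lemma I_trans n (x y z : vilenkin m) : I_ n x y -> I_ n y z -> I_ n x z.
Proof. by move=> xy yz k kn; rewrite yz// xy. Qed.

Lemma I_le k n (x y : vilenkin m) : (k <= n)%N -> I_ n x y -> I_ k x y.
Proof. by move=> kn xy j jk; apply: xy; apply: leq_trans kn. Qed.

Lemma pt_surj n (x : vilenkin m) : exists2 a, (a < M_ m n)%N & I_ n (pt a) x.
Proof.
elim: n => [|n [a aM ax]]; first by exists 0%N; rewrite ?M_0.
exists (x n * M_ m n + a)%N.
  rewrite M_S (@leq_trans ((x n).+1 * M_ m n))//; first by rewrite mulSn addnC ltn_add2r.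
  by rewrite mulnC leq_mul2l vilenkin_lt orbT.
move=> k; rewrite ltnS leq_eqVlt => /predU1P[->|kn]; last first.
  rewrite (ax _ kn); apply: val_inj; rewrite [LHS]pt_val [RHS]pt_val.
  by rewrite digitMD_small.
apply: val_inj; rewrite [RHS]pt_val /digit divnMDl ?M_gt0// divn_small//.
by rewrite addn0 modn_small ?vilenkin_lt.
Qed.

End mixed_radix.

Lemma conjcM (R : rcfType) (x y : R[i]) : conjc (x * y) = conjc x * conjc y.
Proof. exact: rmorphM. Qed.

(** * Characters and Dirichlet kernels *)

Section characters.
Context (R : realType) (m : nat -> nat).
Hypothesis m_ge2 : forall k, (1 < m k)%N.
Notation rad := (@rademacher R m).
Notation ps := (@psi R m).

Definition expi (t : R) : R[i] := Complex (cos t) (sin t).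

Lemma expiD s t : expi (s + t) = expi s * expi t.
Proof.
apply/eqP; rewrite eq_complex /= cosD sinD; apply/andP; split; apply/eqP => //.
by ring.
Qed.

Lemma expi0 : expi 0 = 1.
Proof. by rewrite /expi cos0 sin0. Qed.

Lemma expiMn t n : expi (t *+ n) = expi t ^+ n.
Proof. by elim: n => [|n IH]; rewrite ?expi0// mulrS expiD IH exprS. Qed.

Lemma expi2pi n : expi (pi *+ 2 *+ n) = 1.
Proof. by rewrite expiMn /expi cos2pi sin2pi expr1n. Qed.

Lemma normc_expi t : Normc.normc (expi t) = 1.
Proof. by rewrite /= cos2Dsin2 sqrtr1. Qed.

Lemma conjc_expi t : conjc (expi t) = expi (- t).
Proof. by rewrite /expi cosN sinN. Qed.

Lemma expi_neq1 t : 0 < t < pi *+ 2 -> expi t != 1.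
Proof.
move=> /andP[t0 t2]; have s0 : 0 < sin (t / 2).
  by apply: sin_gt0_pi; move: t2; rewrite mulr2n => t2; lra.
rewrite eq_complex/= negb_and; apply/orP; left.
have -> : t = (t / 2) *+ 2 by rewrite -mulr_natr divfK.
rewrite cos_mulr2n cos2sin2 lt_eqF//.
have : 0 < sin (t / 2) ^+ 2 by rewrite exprn_gt0.
by rewrite mulr2n; lra.
Qed.

Lemma rademacherE k x : rad k x = expi (pi *+ 2 * (x k : nat)%:R / (m k)%:R).
Proof. by rewrite /rademacher -[pi *+ 2]mulr_natl. Qed.

Lemma rademacherX k x : rad k x ^+ m k = 1.
Proof.
rewrite rademacherE -expiMn -[_ *+ m k]mulr_natr divfK ?mulr_natr ?expi2pi//.
by rewrite pnatr_eq0 -lt0n ltnW.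
Qed.

Lemma normc_rademacher k x : Normc.normc (rad k x) = 1.
Proof. by rewrite rademacherE normc_expi. Qed.

Lemma rademacher_conj k x : rad k x * conjc (rad k x) = 1.
Proof. by rewrite rademacherE conjc_expi -expiD subrr expi0. Qed.

(** Up to conjugation, the angle 2 pi (x_k - y_k) / m_k lies strictly between 0 and 2 pi. *)
Lemma rademacher_sep k x y : x k != y k -> rad k x * conjc (rad k y) != 1.
Proof.
wlog xy : x y / (y k < x k)%N => [H ne|_].
  have [lt|] := ltnP (y k) (x k); first exact: H.
  rewrite leq_eqVlt => /predU1P[/val_inj E|lt]; first by rewrite E eqxx in ne.
  rewrite -(can_eq (@conjcK R)) conjcM conjcK conjc1 mulrC; apply: H => //.
  by rewrite eq_sym.
rewrite !rademacherE conjc_expi -expiD expi_neq1//.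
have m0 : 0 < (m k)%:R :> R by rewrite ltr0n ltnW.
have p0 : 0 < pi *+ 2 :> R by rewrite mulrn_wgt0// pi_gt0.
rewrite -mulrBl -mulrBr -natrB ?(ltnW xy)//; apply/andP; split.
  by rewrite !mulr_gt0// ?invr_gt0// ltr0n subn_gt0.
rewrite ltr_pdivrMr// ltr_pM2l// ltr_nat.
exact: leq_ltn_trans (leq_subr _ _) (vilenkin_lt m_ge2 x k).
Qed.

(** Both products extend to [maxn n L] factors, since the added digits are 0. *)
Lemma psi_widen n L x : (n < M_ m L)%N -> ps n x = \prod_(k < L) rad k x ^+ digit m n k.
Proof.
move=> nL; pose F k := rad k x ^+ digit m n k.
have H a b : (a <= b)%N -> (n < M_ m a)%N -> \prod_(k < b) F k = \prod_(k < a) F k.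
  move=> ab na; rewrite (big_ord_widen_cond b xpredT F ab).
  rewrite [LHS](bigID (fun i : 'I_b => (i < a)%N))/=.
  rewrite [X in _ * X]big1 ?mulr1// => i; rewrite -leqNgt => ai.
  by rewrite /F (digit_ge m_ge2 na).
rewrite /psi -/F -(H n (maxn n L)) ?leq_maxl ?ltn_M_//.
by rewrite -(H L (maxn n L)) ?leq_maxr.
Qed.

Lemma psi_I n L x y : (n < M_ m L)%N -> I_ L x y -> ps n x = ps n y.
Proof.
move=> nL xy; rewrite !(psi_widen _ nL); apply: eq_bigr => k _.
by rewrite !rademacherE xy.
Qed.

Lemma psiMD n q i x : (i < M_ m n)%N -> ps (q * M_ m n + i) x = ps (q * M_ m n) x * ps i x.
Proof.
move=> iM; set L := (q * M_ m n + i)%N.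
have LL : (L < M_ m (maxn L n))%N.
  by rewrite (leq_trans (ltn_M_ m_ge2 L))// leq_M ?leq_maxl.
rewrite (psi_widen _ LL) (@psi_widen (q * M_ m n) (maxn L n)); last first.
  by rewrite (leq_ltn_trans _ LL)// leq_addr.
rewrite (@psi_widen i (maxn L n)); last by rewrite (leq_ltn_trans _ LL)// leq_addl.
by rewrite -big_split/=; apply: eq_bigr => k _; rewrite -exprD digitMD.
Qed.

Lemma psi_rademacher n s x : (s < m n)%N -> ps (s * M_ m n) x = rad n x ^+ s.
Proof.
move=> sn; have sM : (s * M_ m n < M_ m n.+1)%N.
  by rewrite M_S mulnC ltn_pmul2l ?M_gt0.
rewrite (psi_widen _ sM) big_ord_recr/= big1 ?mul1r => [|k _].
  by rewrite /digit mulnK ?M_gt0// modn_small.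
by rewrite digitM_small ?ltn_ord.
Qed.

Lemma psi0 x : ps 0 x = 1. Proof. by rewrite /psi big_ord0. Qed.

Lemma normc_psi n x : Normc.normc (ps n x) = 1.
Proof.
by rewrite /psi normc_prod big1// => k _; rewrite normcX normc_rademacher expr1n.
Qed.

(** This is D_n(x - y), written without the group operation. *)
Definition dirichlet n x y : R[i] := \sum_(k < n) ps k x * conjc (ps k y).

Lemma dirichlet_class n j x y z : (n <= M_ m j)%N -> I_ j y z ->
  dirichlet n x y = dirichlet n x z.
Proof.
move=> nM yz; apply: eq_bigr => k _; apply: (congr1 (fun z => _ * conjc z)).
by apply: (@psi_I _ j) => //; apply: leq_trans nM.
Qed.

Lemma dirichlet_classl n j x y z : (n <= M_ m j)%N -> I_ j x y ->
  dirichlet n x z = dirichlet n y z.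
Proof.
move=> nM xy; apply: eq_bigr => k _; apply: (congr1 (fun z => z * _)).
by apply: (@psi_I _ j) => //; apply: leq_trans nM.
Qed.

Lemma normc_dirichlet n x y : Normc.normc (dirichlet n x y) <= n%:R.
Proof.
rewrite (le_trans (normc_sum _ _ _))// (eq_bigr (fun=> 1)) => [|k _].
  by rewrite sumr_const card_ord.
by rewrite Normc.normcM normc_conj !normc_psi mulr1.
Qed.

Lemma dirichletMD n q r x y : (r <= M_ m n)%N ->
  dirichlet (q * M_ m n + r) x y = dirichlet (q * M_ m n) x y +
    ps (q * M_ m n) x * conjc (ps (q * M_ m n) y) * dirichlet r x y.
Proof.
move=> rM; rewrite /dirichlet big_split_ord/=; congr (_ + _).
rewrite mulr_sumr; apply: eq_bigr => i _.
by rewrite !psiMD ?(leq_trans (ltn_ord i))// conjcM mulrACA.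
Qed.

Lemma dirichletM n q x y : dirichlet (q * M_ m n) x y =
  (\sum_(s < q) ps (s * M_ m n) x * conjc (ps (s * M_ m n) y)) * dirichlet (M_ m n) x y.
Proof.
elim: q => [|q IH]; first by rewrite mul0n /dirichlet !big_ord0 mul0r.
by rewrite mulSnr dirichletMD// IH big_ord_recr/= mulrDl.
Qed.

(** Paley's formula. From [n] to [n.+1] the kernel is multiplied by the sum of z^s, s < m_n, where z
    is the product of r_n(x) and the conjugate of r_n(y). As z^{m_n} = 1, the sum is m_n if z = 1
    and 0 otherwise. *)
Lemma dirichlet_M n x y : dirichlet (M_ m n) x y =
  if `[< I_ n x y >] then (M_ m n)%:R else 0.
Proof.
elim: n => [|n IH].
  rewrite M_0 /dirichlet big_ord1 !psi0 mul1r conjc1.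
  by case: asboolP => // -[].
rewrite M_S mulnC dirichletM {}IH.
rewrite (eq_bigr (fun s : 'I_(m n) => (rad n x * conjc (rad n y)) ^+ s)) => [|s _]; last first.
  by rewrite psi_rademacher// psi_rademacher// exprMn rmorphXn.
case: (asboolP (I_ n x y)) => xy; last first.
  rewrite mulr0; case: asboolP => // xy'; exfalso; apply: xy.
  exact: I_le xy'.
case: (eqVneq (x n) (y n)) => xyn.
  have -> : rad n y = rad n x by rewrite !rademacherE xyn.
  rewrite rademacher_conj (eq_bigr (fun=> 1)) => [|s _]; last by rewrite expr1n.
  rewrite sumr_const card_ord -natrM; case: asboolP => // -[] k.
  by rewrite ltnS leq_eqVlt => /predU1P[->//|]; exact: xy.
have z1 := rademacher_sep xyn; set z := _ * _ in z1 *.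
have zm : z ^+ m n = 1 by rewrite exprMn -[conjc _ ^+ _]rmorphXn !(rademacherX n) rmorph1 mulr1.
have /eqP : (z - 1) * \sum_(s < m n) z ^+ s = 0 by rewrite -subrX1 zm subrr.
rewrite mulf_eq0 subr_eq0 (negbTE z1)/= => /eqP ->; rewrite mul0r.
case: asboolP => // /(_ n (ltnSn _)) E; by rewrite E eqxx in xyn.
Qed.

(** Write [n = q * M_ m k + r] with [r < M_ m k]. The first [q * M_ m k] terms have the factor
    D_{M_k}, which vanishes at separated points; the rest is D_r up to a factor of modulus 1. *)
Lemma dirichlet_sep n k x y : ~ I_ k x y -> Normc.normc (dirichlet n x y) <= (M_ m k)%:R.
Proof.
move=> xy; rewrite (divn_eq n (M_ m k)) dirichletMD; last by rewrite ltnW// ltn_mod M_gt0.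
rewrite dirichletM dirichlet_M asboolF// mulr0 add0r !Normc.normcM normc_conj.
rewrite !normc_psi !mul1r (le_trans (normc_dirichlet _ _ _))// ler_nat.
by rewrite ltnW// ltn_mod M_gt0.
Qed.

End characters.

(** * Integration of functions of finitely many coordinates *)

Section level.
Context (m : nat -> nat).
Hypothesis m_ge2 : forall k, (1 < m k)%N.

Definition level_fun (T : Type) N (F : vilenkin m -> T) :=
  forall x y, I_ N x y -> F x = F y.

Lemma measurable_I n (x : vilenkin m) : measurable (I_ n x).
Proof. by apply: sub_sigma_algebra; exists n, x. Qed.

Lemma measurable_level d (T : measurableType d) N (F : vilenkin m -> T) :
  level_fun N F -> measurable_fun setT F.
Proof.
move=> FN _ Y mY; rewrite setTI.
have -> : F @^-1` Y = \bigcup_(a in [set a | Y (F (pt m a))]) I_ N (pt m a).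
  apply/seteqP; split=> [x /= Yx|x [a /= Ya ax]].
    by have [a aM ax] := pt_surj m_ge2 N x; exists a => //=; rewrite (FN _ _ ax).
  by rewrite /preimage/= -(FN _ _ ax).
by apply: bigcup_measurable => a _; exact: measurable_I.
Qed.

Lemma level_funE (V : pzRingType) N (F : vilenkin m -> V) x : level_fun N F ->
  F x = \sum_(a < M_ m N) F (pt m a) * `[< I_ N (pt m a) x >]%:R.
Proof.
move=> FN; have [a aM ax] := pt_surj m_ge2 N x.
rewrite (bigD1 (Ordinal aM))//= asboolT// mulr1 big1 ?addr0 ?(FN _ _ ax)//.
move=> b ba; rewrite asboolF ?mulr0// => bx; move/eqP: ba; apply.
apply: val_inj => /=; have := I_trans ax (I_sym bx).
by move/(I_pt m_ge2); rewrite !modn_small// => /esym.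
Qed.

Lemma level_I k N (x : vilenkin m) : (k <= N)%N ->
  level_fun N (fun y => `[< I_ k x y >]).
Proof.
move=> kN y z yz; apply/asboolP/asboolP => xy.
  exact: I_trans xy (I_le kN yz).
exact: I_trans xy (I_sym (I_le kN yz)).
Qed.

End level.

Section integral_level.
Context (R : realType) (m : nat -> nat).
Hypothesis m_ge2 : forall k, (1 < m k)%N.
Context (mu : probability (vilenkin m) R).
Hypothesis mu_haar : normalized_haar mu.

Lemma mu_I n x : (mu : {measure set (vilenkin m) -> \bar R}) (I_ n x) = ((M_ m n)%:R^-1)%:E.
Proof. by rewrite mu_haar prodfV /M_ natr_prod. Qed.

(** Expanding [h] over the cylinders turns the product into a finite combination of restrictions of
    [phi]. *)
Lemma integral_mul_level N (phi h : vilenkin m -> R) :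
  mu.-integrable setT (EFin \o phi) -> level_fun N h ->
  mu.-integrable setT (fun x => (phi x * h x)%:E) /\
  Rintegral mu setT (fun x => phi x * h x) =
    \sum_(a < M_ m N) h (pt m a) * Rintegral mu (I_ N (pt m a)) phi.
Proof.
move=> ip hN.
pose g a x : \bar R := ((h (pt m a))%:E * ((EFin \o phi) \_ (I_ N (pt m a))) x)%E.
have gE x : (phi x * h x)%:E = (\sum_(a < M_ m N) g a x)%E.
  rewrite (level_funE m_ge2 x hN) mulr_sumr -sumEFin; apply: eq_bigr => a _.
  rewrite /g patchE /=; case: ifPn => [/set_mem ax|/negP ax].
    by rewrite asboolT// mulr1 -EFinM mulrC.
  by rewrite asboolF ?mulr0 ?mule0// => H; apply: ax; rewrite inE.
have iI a : mu.-integrable setT ((EFin \o phi) \_ (I_ N (pt m a))).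
  have mI := measurable_I N (pt m a).
  by apply/(integrable_mkcond _ mI); exact: integrableS ip.
have ig a : mu.-integrable setT (g a) by apply: integrableZl.
split.
  rewrite (_ : (fun x => _) = (fun x => \sum_(a < M_ m N) g a x)%E).
    exact: integrable_sum.
  exact/funext.
rewrite /Rintegral (eq_integral _ _ (fun x _ => gE x)).
rewrite integral_sum//.
rewrite (eq_bigr (fun a : 'I_(M_ m N) => (h (pt m a) * Rintegral mu (I_ N (pt m a)) phi)%:E)).
  by rewrite sumEFin.
move=> a _; rewrite /g integralZl// EFinM; congr (_ * _)%E.
rewrite -integral_mkcond /Rintegral fineK//.
apply: integral_fune_fin_num; first exact: measurable_I.
by apply: integrableS ip => //; exact: measurable_I.
Qed.

Lemma integral_level N (h : vilenkin m -> R) : level_fun N h ->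
  mu.-integrable setT (EFin \o h) /\
  (\int[mu]_x (h x)%:E = ((\sum_(a < M_ m N) h (pt m a)) / (M_ m N)%:R)%:E)%E.
Proof.
move=> hN.
have [] := @integral_mul_level N (fun=> 1) h _ hN.
  apply: measurable_bounded_integrable => //.
    exact: le_lt_trans (probability_le1 mu measurableT) (ltry _).
  exact: bounded_cst.
rewrite (_ : (fun x => (1 * h x)%:E) = EFin \o h); last by apply/funext => x; rewrite mul1r.
move=> ih hE; split=> //; rewrite -[LHS]fineK; last exact: integral_fune_fin_num.
congr _%:E; move: hE; rewrite /Rintegral; under eq_integral do rewrite mul1r.
move=> ->; rewrite mulr_suml; apply: eq_bigr => a _; congr (_ * _).
rewrite -/(Rintegral _ _ _) Rintegral_cst; last exact: measurable_I.
by rewrite mul1r mu_I.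
Qed.

Lemma cintegral_mul_level N f (h : vilenkin m -> R[i]) :
  cintegrable mu setT f -> level_fun N h ->
  cintegral mu setT (fun x => f x * h x) =
    \sum_(a < M_ m N) h (pt m a) * cintegral mu (I_ N (pt m a)) f.
Proof.
move=> [ifr ifi] hN.
have hr : level_fun N (fun x => complex.Re (h x)) by move=> x y /hN ->.
have hi : level_fun N (fun x => complex.Im (h x)) by move=> x y /hN ->.
have [irr Err] := integral_mul_level ifr hr.
have [iri Eri] := integral_mul_level ifr hi.
have [iir Eir] := integral_mul_level ifi hr.
have [iii Eii] := integral_mul_level ifi hi.
have ReM (x y : R[i]) : complex.Re (x * y) =
  complex.Re x * complex.Re y - complex.Im x * complex.Im y by case: x; case: y.
have ImM (x y : R[i]) : complex.Im (x * y) =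
  complex.Re x * complex.Im y + complex.Im x * complex.Re y by case: x; case: y.
apply/eqP; rewrite eq_complex !raddf_sum /cintegral/=; apply/andP; split; apply/eqP.
  under eq_Rintegral do rewrite ReM.
  rewrite RintegralB// Err Eii -sumrB; apply: eq_bigr => a _.
  by rewrite ReM.
under eq_Rintegral do rewrite ImM.
rewrite RintegralD// Eri Eir -big_split/=; apply: eq_bigr => a _.
by rewrite ImM addrC.
Qed.

Lemma cintegral_I k N f x : cintegrable mu setT f -> (k <= N)%N ->
  cintegral mu (I_ k x) f =
  \sum_(a < M_ m N) `[< I_ k x (pt m a) >]%:R * cintegral mu (I_ N (pt m a)) f.
Proof.
move=> cf kN.
rewrite -(@cintegral_mul_level N f (fun y => `[< I_ k x y >]%:R))//; last first.
  by move=> y z yz; rewrite (level_I x kN yz).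
rewrite /cintegral; congr Complex; rewrite Rintegral_mkcond; apply: eq_Rintegral => y _.
  rewrite patchE; case: ifPn => [/set_mem xy|/negP xy]; first by rewrite asboolT// mulr1.
  by rewrite asboolF ?mulr0// => H; apply: xy; rewrite inE.
rewrite patchE; case: ifPn => [/set_mem xy|/negP xy]; first by rewrite asboolT// mulr1.
by rewrite asboolF ?mulr0// => H; apply: xy; rewrite inE.
Qed.

Lemma fourier_sum_level n N f x : cintegrable mu setT f -> (n <= M_ m N)%N ->
  fourier_sum mu n f x =
  \sum_(a < M_ m N) cintegral mu (I_ N (pt m a)) f * dirichlet R n x (pt m a).
Proof.
move=> cf nM; rewrite /fourier_sum.
transitivity (\sum_(k < n) (\sum_(a < M_ m N) conjc (psi R k (pt m a)) *
    cintegral mu (I_ N (pt m a)) f) * psi R k x).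
  apply: eq_bigr => k _; congr (_ * _).
  rewrite /fourier_coef (@cintegral_mul_level N)// => y z yz.
  by rewrite (psi_I R m_ge2 _ yz)// (leq_trans (ltn_ord k)).
under eq_bigr do rewrite mulr_suml.
rewrite exchange_big/=; apply: eq_bigr => a _; rewrite mulr_sumr.
by apply: eq_bigr => k _; ring.
Qed.

(** The measure of [I_ n x] computed twice: by counting cylinders of level [N], and from the
    normalization of [mu]. *)
Lemma sum_I n N x : (n <= N)%N ->
  \sum_(a < M_ m N) `[< I_ n x (pt m a) >]%:R = (M_ m N)%:R / (M_ m n)%:R :> R.
Proof.
move=> nN.
have hN : level_fun N (fun y => `[< I_ n x y >]%:R : R).
  by move=> y z yz; rewrite (level_I x nN yz).
have [_] := integral_level hN.
rewrite (_ : (fun y => _) = (fun y => (\1_(I_ n x) y)%:E)); last first.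
  by apply/funext => y; rewrite indicE.
rewrite integral_indic ?setIT; [|by []|exact: measurable_I].
have M0 : (M_ m N)%:R != 0 :> R by rewrite pnatr_eq0 -lt0n M_gt0.
by rewrite mu_I => -[->]; rewrite mulrC divfK.
Qed.

Lemma card_level n N a : (n <= N)%N ->
  (#|[pred b : 'I_(M_ m N) | a %% M_ m n == b %% M_ m n]| * M_ m n = M_ m N)%N.
Proof.
move=> nN; apply/eqP; rewrite -(eqr_nat R) natrM -sum1_card natr_sum big_mkcond/=.
have M0 : (M_ m n)%:R != 0 :> R by rewrite pnatr_eq0 -lt0n M_gt0.
rewrite -[in eqbRHS](divfK M0 (M_ m N)%:R) -(sum_I (pt m a) nN); apply/eqP.
congr (_ * _); apply: eq_bigr => b _; rewrite inE.
case: ifPn => [/eqP/(I_pt m_ge2) ab|/eqP ab]; first by rewrite asboolT.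
by rewrite asboolF// => /(I_pt m_ge2)/ab.
Qed.

End integral_level.

(** * Boundedness *)

Section harmonic.
Context (R : realType).

(** The real counterpart of [log_norm], which lives in [R[i]]. *)
Definition harmonic_sum n : R := \sum_(1 <= k < n.+1) k%:R^-1.

Lemma log_normE n : log_norm R n = (harmonic_sum n)%:C%C.
Proof.
rewrite /log_norm /harmonic_sum rmorph_sum/=; apply: eq_bigr => k _.
by rewrite fmorphV rmorph_nat.
Qed.

Lemma harmonic_sumS n : harmonic_sum n.+1 = harmonic_sum n + n.+1%:R^-1.
Proof. by rewrite /harmonic_sum big_nat_recr. Qed.

Lemma harmonic_sum0 : harmonic_sum 0 = 0.
Proof. by rewrite /harmonic_sum big_geq. Qed.

Lemma harmonic_sum_ge0 n : 0 <= harmonic_sum n.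
Proof. by apply: sumr_ge0 => k _; rewrite invr_ge0. Qed.

Lemma harmonic_sum_gt0 n : (0 < n)%N -> 0 < harmonic_sum n.
Proof.
by case: n => // n _; rewrite harmonic_sumS ltr_wpDl ?harmonic_sum_ge0// invr_gt0.
Qed.

Lemma harmonic_sum_rev n : \sum_(k < n) (n - k)%:R^-1 = harmonic_sum n.
Proof.
rewrite /harmonic_sum big_add1/= big_mkord.
rewrite (reindex_inj rev_ord_inj)/=; apply: eq_bigr => k _.
by rewrite subKn.
Qed.

End harmonic.

Section norlund.
Context (R : realType) (m : nat -> nat) (mu : {measure set (vilenkin m) -> \bar R}).

(* The weights [1 / ((n - k) l_n)] add up to 1 and [S_0 f = 0]. *)
Lemma norlund_log_mean_le n f x A : (0 < n)%N -> 0 <= A ->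
  (forall k, (0 < k < n)%N -> Normc.normc (fourier_sum mu k f x) <= A) ->
  Normc.normc (norlund_log_mean mu n f x) <= A.
Proof.
move=> n0 A0 SA; rewrite /norlund_log_mean log_normE Normc.normcM Normc.normcV.
rewrite normc_real ger0_norm ?harmonic_sum_ge0// mulrC ler_pdivrMr ?harmonic_sum_gt0//.
rewrite (le_trans (normc_sum _ _ _))// -harmonic_sum_rev mulr_sumr ler_sum// => k _.
rewrite Normc.normcM Normc.normcV normc_nat ler_wpM2r ?invr_ge0//.
case: (posnP k) => [->|k0]; first by rewrite /fourier_sum big_ord0 Normc.normc0.
by apply: SA; rewrite k0 ltn_ord.
Qed.

End norlund.

(** * The maximal operator with logarithmic weight *)

Section partA.
Context (R : realType) (m : nat -> nat).
Hypothesis m_ge2 : forall k, (1 < m k)%N.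

Lemma expn2_le_M j : (2 ^ j <= M_ m j)%N.
Proof.
elim: j => [|j IH]; first by rewrite M_0.
by rewrite M_S expnSr leq_mul.
Qed.

(** From [2 ^ j <= M_ m j <= n] and [2 <= n.+1] follows [2 ^ j.+1 <= n.+1 ^ 2], whence the constant
    [2 / ln 2]. *)
Lemma log_weight_ge n j : (0 < n)%N -> (M_ m j <= n)%N ->
  j.+1%:R <= 2 / ln 2 * ln n.+1%:R :> R.
Proof.
move=> n0 Mn; have l2 : 0 < ln 2 :> R by rewrite ln_gt0// ltr1n.
rewrite mulrAC ler_pdivlMr// mulr_natl -lnXn// mulr_natl -lnXn//.
rewrite ler_ln ?posrE ?exprn_gt0// -!natrX ler_nat expnS -mulnn leq_mul//.
by rewrite (leq_trans (expn2_le_M j))// (leq_trans Mn).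
Qed.

Context (B : nat).
Hypothesis m_le : forall k, (m k <= B)%N.
Context (mu : probability (vilenkin m) R).
Hypothesis mu_haar : normalized_haar mu.

Local Notation mu' := (mu : {measure set (vilenkin m) -> \bar R}).

(** The martingale of [f], as [I_ n x] has measure [1 / M_ m n]. *)
Definition level_avg n f (x : vilenkin m) : R[i] :=
  (M_ m n)%:R * cintegral mu' (I_ n x) f.

Lemma hardy_maximalE f x : hardy_maximal mu' f x =
  ereal_sup (range (fun n => (Normc.normc (level_avg n f x))%:E)).
Proof.
congr ereal_sup; apply/seteqP; split=> _ [n _ <-]; exists n => //=;
by rewrite mu_I//= invrK Normc.normcM normc_nat.
Qed.

Lemma level_avg_level n N f : (n <= N)%N -> level_fun N (level_avg n f).
Proof.
move=> nN x y xy; rewrite /level_avg; congr (_ * cintegral _ _ _).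
apply/seteqP; split=> z.
  by apply: I_trans; apply: I_sym; exact: I_le xy.
by apply: I_trans; exact: I_le xy.
Qed.

Lemma hardy_maximal_ge0 f x : (0 <= hardy_maximal mu' f x)%E.
Proof.
rewrite hardy_maximalE; apply: ereal_sup_ge; exists (Normc.normc (level_avg 0 f x))%:E.
  by exists 0%N.
by rewrite lee_fin normc_ge0.
Qed.

Lemma measurable_hardy_maximal f : measurable_fun setT (hardy_maximal mu' f).
Proof.
pose u n x := (Normc.normc (level_avg n f x))%:E.
rewrite (_ : hardy_maximal mu' f = fun x => esups (u ^~ x) 0%N).
  apply: measurable_fun_esups => n; apply: (measurable_level m_ge2 (N := n)).
  by move=> x y xy; rewrite /u (level_avg_level f (leqnn n) xy).
apply/funext => x; rewrite hardy_maximalE; congr ereal_sup.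
by apply/seteqP; split=> _ [n _ <-]; exists n.
Qed.

Lemma hardy_normE f : hardy_norm mu' f = (\int[mu']_x hardy_maximal mu' f x)%E.
Proof. by apply: eq_integral => x _; rewrite gee0_abs ?hardy_maximal_ge0. Qed.

(** Transfers [sublinear_maximal_inequality] to the set of cylinders of level [N]. The function [G]
    depends on [N], the constant does not. *)
Lemma partial_sums_bound N f : cintegrable mu' setT f ->
  exists2 G : 'I_(M_ m N) -> R,
    forall n (b : 'I_(M_ m N)) x, (0 < n < M_ m N)%N -> I_ N (pt m b) x ->
      Normc.normc (fourier_sum mu' n f x) <= 2 / ln 2 * ln n.+1%:R * G b &
    \sum_b G b <= (B.+1%:R + 6 * B%:R * (2 * B%:R + 1)) *
      \sum_(b < M_ m N) \big[Num.max/0]_(n < N.+1) Normc.normc (level_avg n f (pt m b)).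
Proof.
move=> cf.
(* By [I_pt], residues modulo [M_ m n] stand for the cylinders of level [n]. *)
pose e n (a b : 'I_(M_ m N)) := (a %% M_ m n == b %% M_ m n)%N.
pose F (a : 'I_(M_ m N)) := level_avg N f (pt m a).
have M0 k : (M_ m k)%:R != 0 :> R[i] by rewrite pnatr_eq0 -lt0n M_gt0.
have card_e n (x : 'I_(M_ m N)) : (n <= N)%N ->
    (#|[pred y | e n x y]| * M_ m n = #|'I_(M_ m N)|)%N.
  by move=> nN; rewrite card_ord (card_level m_ge2 mu_haar).
have FE n a : (n <= N)%N -> cond_mean e n F a = level_avg n f (pt m a).
  move=> nN; rewrite /cond_mean /level_avg (cintegral_I m_ge2 _ cf nN).
  have c0 : #|[pred y | e n a y]|%:R != 0 :> R[i].
    by rewrite pnatr_eq0 -lt0n; apply/card_gt0P; exists a; rewrite inE /e.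
  apply: (mulIf c0); rewrite divfK// mulrAC -natrM mulnC card_e// card_ord.
  rewrite mulr_sumr [LHS]big_mkcond/=; apply: eq_bigr => b _; rewrite /F /level_avg.
  case: ifPn => [/eqP/(I_pt m_ge2) ab|/eqP ab]; first by rewrite asboolT// mul1r.
  by rewrite asboolF ?mul0r ?mulr0// => /(I_pt m_ge2).
pose Fs (a : 'I_(M_ m N)) := \big[Num.max/0]_(n < N.+1) Normc.normc (level_avg n f (pt m a)).
have FFs n x : (n <= N)%N -> Normc.normc (cond_mean e n F x) <= Fs x.
  move=> nN; rewrite FE//.
  exact: (le_bigmax _ (fun k : 'I_N.+1 => Normc.normc (level_avg k f (pt m x)))
    (Ordinal (nN : (n < N.+1)%N))).
have e_sym n : symmetric (e n) by move=> a b; rewrite /e eq_sym.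
have e_trans n : transitive (e n) by move=> b a c; rewrite /e => /eqP->.
have e_le i j a b : (i <= j)%N -> e j a b -> e i a b.
  by move=> ij /eqP/(I_pt m_ge2)/(I_le ij)/(I_pt m_ge2) ab; apply/eqP.
have e_inj a b : e N a b -> a = b.
  by rewrite /e !modn_small// => /eqP/val_inj.
have M_bnd k : (M_ m k.+1 <= B * M_ m k)%N by rewrite M_S mulnC leq_mul2r m_le orbT.
have M_le k : (M_ m k <= M_ m k.+1)%N by exact: leq_M.
pose K n (a b : 'I_(M_ m N)) := dirichlet R n (pt m a) (pt m b).
have K_le n a b : Normc.normc (K n a b) <= n%:R by exact: normc_dirichlet.
have K_sep n k a b : ~~ e k.+1 a b -> Normc.normc (K n a b) <= (M_ m k.+1)%:R.
  move=> /eqP ab; apply: dirichlet_sep => // /(I_pt m_ge2) H; exact: ab.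
have K_class n j a b c : (n <= M_ m j)%N -> e j b c -> K n a b = K n a c.
  by move=> nM /eqP/(I_pt m_ge2) bc; apply: dirichlet_class bc.
have e_refl n : reflexive (e n) by move=> a; rewrite /e.
have [G GS GF] := sublinear_maximal_inequality e_refl e_sym e_trans
  e_le card_e e_inj (M_0 m) (M_gt0 m_ge2) M_le M_bnd K_le K_sep K_class log_weight_ge FFs.
exists G => // n b x nM bx; rewrite (le_trans _ (GS n b nM))//.
have nM' : (n <= M_ m N)%N by case/andP: nM => _ /ltnW.
rewrite (fourier_sum_level m_ge2 _ cf nM').
rewrite le_eqVlt; apply/orP; left; apply/eqP; congr Normc.normc.
rewrite /integral_op mulr_suml; apply: eq_bigr => a _.
rewrite /K (dirichlet_classl R m_ge2 _ nM' bx) card_ord /F /level_avg.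
by rewrite -(mulrA (M_ m N)%:R) mulrAC divff ?mul1r.
Qed.

Lemma fourier_sum_level_fun n N f : (n <= M_ m N)%N ->
  level_fun N (fourier_sum mu' n f).
Proof.
move=> nM x y xy; apply: eq_bigr => k _; apply: (congr1 (fun z => _ * z)).
by apply: (psi_I R m_ge2 _ xy); exact: leq_trans nM.
Qed.

Lemma norlund_level_fun n N f : (n <= M_ m N)%N ->
  level_fun N (norlund_log_mean mu' n f).
Proof.
move=> nM x y xy; apply: (congr1 (fun z => _ * z)); apply: eq_bigr => k _.
apply: (congr1 (fun z => z / _)).
by apply: (@fourier_sum_level_fun k N) => //; apply: leq_trans nM; exact: ltnW.
Qed.

Lemma weighted_maximal_ge0 w f x : 0 <= w 1%N -> (0 <= weighted_maximal mu' w f x)%E.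
Proof.
move=> w0; apply: ereal_sup_ge.
exists (Normc.normc (norlund_log_mean mu' 1 f x) / w 1%N)%:E; first by exists 1%N.
by rewrite lee_fin mulr_ge0 ?normc_ge0 ?invr_ge0.
Qed.

(** Monotone convergence in the truncation to [n < M_ m N.+1]: the truncated supremum depends on
    [N.+1] coordinates only, so [partial_sums_bound] applies, with a constant free of [N]. *)
Lemma bounded_log_maximal :
  bounded_H1_L1 mu' (weighted_maximal mu' (fun n => ln (n.+1%:R : R))).
Proof.
pose c : R := 2 / ln 2; pose c' : R := B.+1%:R + 6 * B%:R * (2 * B%:R + 1).
have c0 : 0 <= c by rewrite divr_ge0// ltW// ln_gt0// ltr1n.
have c'0 : 0 <= c' by rewrite addr_ge0 ?mulr_ge0 ?addr_ge0 ?mulr_ge0.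
exists (c * c') => f [cf _].
pose u n x := (Normc.normc (norlund_log_mean mu' n f x) / ln (n.+1%:R : R))%:E.
(* With [N.+1] in place of [N] the range always contains [n = 1], so no supremum is over the empty
   set. *)
pose S N x := ereal_sup [set u n x | n in [set n | (0 < n < M_ m N.+1)%N]].
have u0 n x : (0 <= u n x)%E.
  by rewrite lee_fin divr_ge0 ?normc_ge0 ?ln_ge0// ler1n.
have M1 N : (1 < M_ m N.+1)%N by apply: leq_trans (expn2_le_M _); rewrite -{1}(expn1 2) leq_exp2l.
have S0 N x : (0 <= S N x)%E.
  by apply: ereal_sup_ge; exists (u 1%N x) => //; exists 1%N => //=; rewrite M1.
have S_level N : level_fun N.+1 (S N).
  have H x y : I_ N.+1 x y -> (S N x <= S N y)%E.
    move=> xy; apply: le_ereal_sup => _ [n nM <-]; exists n; first exact: nM.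
    by case/andP: nM => _ /ltnW nM; rewrite /u (norlund_level_fun f nM xy).
  move=> x y xy; apply/eqP; rewrite eq_le.
  by apply/andP; split; apply: H; [exact: xy|exact: I_sym].
have mS N : measurable_fun setT (S N) by exact: measurable_level (S_level N).
have S_homo x : {homo (fun N => S N x) : n k / (n <= k)%N >-> (n <= k)%E}.
  move=> n k nk; apply: le_ereal_sup => _ [j /andP[j0 jn] <-]; exists j => //=.
  by rewrite j0 (leq_trans jn)// leq_M.
have TS x : weighted_maximal mu' (fun n => ln (n.+1%:R : R)) f x = limn (fun N => S N x).
  apply/esym/cvg_lim => //.
  rewrite (_ : weighted_maximal _ _ _ _ = ereal_sup (range (fun N => S N x))).
    exact: ereal_nondecreasing_cvgn.
  apply/eqP; rewrite eq_le; apply/andP; split.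
    apply: ge_ereal_sup => _ [n n0 <-]; apply: ereal_sup_ge.
    exists (S n x); first by exists n.
    apply: ereal_sup_ubound; exists n => //=; rewrite n0 (leq_trans (ltn_M_ m_ge2 n))//.
    by rewrite leq_M.
  apply: ge_ereal_sup => _ [N _ <-]; apply: le_ereal_sup => _ [n /andP[n0 _] <-].
  by exists n.
have bnd N : (\int[mu']_x S N x <= (c * c')%:E * hardy_norm mu' f)%E.
  have [G GS GF] := partial_sums_bound N.+1 cf.
  have /choice[idx idxP] (x : vilenkin m) : exists a : 'I_(M_ m N.+1), I_ N.+1 (pt m a) x.
    by have [a aM ax] := pt_surj m_ge2 N.+1 x; exists (Ordinal aM).
  have idx_eq (a : 'I_(M_ m N.+1)) x : I_ N.+1 (pt m a) x -> idx x = a.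
    move=> ax; apply: val_inj; have := I_trans (idxP x) (I_sym ax).
    by move/(I_pt m_ge2); rewrite !modn_small.
  pose g x : R := c * G (idx x).
  have g_level : level_fun N.+1 g.
    by move=> x y xy; rewrite /g (idx_eq _ _ (I_trans (idxP y) (I_sym xy))).
  pose Fs x : R := \big[Num.max/0]_(n < N.+2) Normc.normc (level_avg n f x).
  have Fs_level : level_fun N.+1 Fs.
    by move=> x y xy; apply: eq_bigr => n _; rewrite (level_avg_level f _ xy)// -ltnS.
  have Sg x : (S N x <= (g x)%:E)%E.
    apply: ge_ereal_sup => _ [n /andP[n0 nM] <-].
    have G0 : 0 <= G (idx x).
      have := le_trans (normc_ge0 _) (GS 1%N (idx x) x (M1 N) (idxP x)).
      by rewrite pmulr_rge0// mulr_gt0 ?divr_gt0 ?ln_gt0 ?ltr1n.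
    have ln0 : 0 < ln (n.+1%:R : R) by rewrite ln_gt0// ltr1n.
    (* As [ln] is increasing, the weight of [n] serves for all S_k with [k <= n], and the bound
       passes to their average. *)
    have gln k : (0 < k <= n)%N ->
        Normc.normc (fourier_sum mu' k f x) <= g x * ln n.+1%:R.
      move=> /andP[k0 kn]; have kM : (0 < k < M_ m N.+1)%N by rewrite k0 (leq_ltn_trans kn).
      rewrite (le_trans (GS k _ x kM (idxP x)))// -/c /g mulrAC ler_wpM2l//.
        by rewrite mulr_ge0.
      by rewrite ler_ln ?posrE ?ltr0n// ler_nat.
    rewrite lee_fin ler_pdivrMr//; apply: norlund_log_mean_le => //.
      by apply: le_trans (gln n _); rewrite ?normc_ge0 ?n0 ?leqnn.
    by move=> k /andP[k0 kn]; apply: gln; rewrite k0 ltnW.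
  apply: (@le_trans _ _ (\int[mu']_x (g x)%:E)%E).
    apply: ge0_le_integral => //.
    exact: measurableT_comp (measurable_level m_ge2 g_level).
  have [_ ->] := integral_level m_ge2 mu_haar g_level.
  apply: (@le_trans _ _ ((c * c')%:E * \int[mu']_x (Fs x)%:E)%E).
    have [_ ->] := integral_level m_ge2 mu_haar Fs_level.
    have gE (b : 'I_(M_ m N.+1)) : g (pt m b) = c * G b.
      by rewrite /g (idx_eq b)//; exact: I_refl.
    rewrite -EFinM lee_fin mulrA ler_wpM2r ?invr_ge0//.
    rewrite (eq_bigr _ (fun b _ => gE b)) -mulr_sumr -[leRHS]mulrA.
    exact: ler_wpM2l.
  rewrite hardy_normE; apply: lee_wpmul2l; first by rewrite lee_fin mulr_ge0.
  apply: ge0_le_integral => //.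
  - by move=> x _; rewrite lee_fin /Fs; apply: bigmax_ge_id.
  - by apply/measurable_EFinP; exact: measurable_level Fs_level.
  - exact: measurable_hardy_maximal.
  move=> x _; rewrite /Fs; apply: (big_ind (fun r => (r%:E <= hardy_maximal mu' f x)%E)).
  - exact: hardy_maximal_ge0.
  - by move=> r s rH sH; case: (leP r s).
  - by move=> n _; rewrite hardy_maximalE; apply: ereal_sup_ubound; exists n.
rewrite /norm1 (eq_integral (fun x => limn (fun N => S N x))); last first.
  by move=> x _; rewrite gee0_abs ?TS// -TS weighted_maximal_ge0// ln_ge0// ler1n.
rewrite monotone_convergence//; apply: lime_le.
  apply: ereal_nondecreasing_is_cvgn => n k nk; apply: ge0_le_integral => //.
  by move=> x _; exact: S_homo.
by apply: nearW.
Qed.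

End partA.

(** * Unboundedness *)

Section harmonic_bounds.
Context (R : realType).
Local Notation H := (@harmonic_sum R).

Lemma harmonic_sum_homo : {homo H : n k / (n <= k)%N >-> n <= k}.
Proof.
apply: homo_leq => [//|x y z|n]; first exact: le_trans.
by rewrite harmonic_sumS lerDl invr_ge0.
Qed.

(** Each doubling of the range adds [2 ^ n] terms of size at least [1 / 2 ^ n.+1], that is at least
    1/2. *)
Lemma harmonic_sum_exp2 n : 1 + n%:R / 2 <= H (2 ^ n).
Proof.
elim: n => [|n IH]; first by rewrite expn0 harmonic_sumS harmonic_sum0 mul0r addr0 add0r invr1.
have step k : (k <= 2 ^ n)%N -> H (2 ^ n) + k%:R / (2 ^ n.+1)%:R <= H (2 ^ n + k).
  elim: k => [|k IHk] kn; first by rewrite mul0r addr0 addn0.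
  rewrite addnS harmonic_sumS -natr1 mulrDl addrA lerD ?IHk 1?ltnW// mul1r.
  by rewrite lef_pV2 ?posrE ?ltr0n ?expn_gt0// ler_nat expnS mul2n -addnn ltn_add2l.
have := step _ (leqnn _); rewrite addnn -mul2n -expnS.
have -> : (2 ^ n)%:R / (2 ^ n.+1)%:R = 2^-1 :> R.
  have E0 : (2 ^ n)%:R != 0 :> R by rewrite pnatr_eq0 -lt0n expn_gt0.
  by rewrite expnS natrM invfM mulrCA divff ?mulr1.
by apply: le_trans; rewrite -natr1; lra.
Qed.

(** Induction, with 1/(n+2) <= ln(n+2) - ln(n+1) obtained from ln(1 - t) <= -t at t = 1/(n+2). *)
Lemma harmonic_sum_le_ln n : (0 < n)%N -> H n <= 1 + ln n%:R.
Proof.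
elim: n => // -[_ _|n IH _]; first by rewrite harmonic_sumS harmonic_sum0 add0r invr1 ln1 addr0.
rewrite harmonic_sumS (le_trans (lerD (IH _) (lexx _)))// -addrA lerD2l.
have n0 : 0 < n.+1%:R :> R by rewrite ltr0n.
have n2 : 0 < n.+2%:R :> R by rewrite ltr0n.
have : ln (1 + - n.+2%:R^-1) <= - n.+2%:R^-1 :> R.
  by apply: le_ln1Dx; rewrite ltrN2 invf_lt1// ltr1n.
have -> : 1 + - n.+2%:R^-1 = n.+1%:R / n.+2%:R :> R.
  rewrite -[n.+2%:R]natr1; move: n0; set a : R := n.+1%:R => n0.
  by field; apply: lt0r_neq0; lra.
rewrite ln_div ?posrE//; move: (ln n.+1%:R) (ln n.+2%:R) (n.+2%:R^-1) => u v t; lra.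
Qed.

(** Termwise, j / (n - j) = n / (n - j) - 1. *)
Lemma sum_div_subn n : \sum_(j < n) j%:R / (n - j)%:R = n%:R * H n - n%:R :> R.
Proof.
rewrite -harmonic_sum_rev mulr_sumr.
rewrite -[X in _ = _ - X](_ : \sum_(j < n) 1 = n%:R); last first.
  by rewrite sumr_const card_ord.
rewrite -sumrB; apply: eq_bigr => j _.
have nj : (n - j)%:R != 0 :> R by rewrite pnatr_eq0 -lt0n subn_gt0.
rewrite -[X in _ - X](divff nj) -mulrBl; congr (_ / _).
by rewrite natrB ?(ltnW (ltn_ord j))//; ring.
Qed.

End harmonic_bounds.

(** * The test functions and their logarithmic means *)

Section partB.
Context (R : realType) (m : nat -> nat).
Hypothesis m_ge2 : forall k, (1 < m k)%N.
Context (mu : probability (vilenkin m) R).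
Hypothesis mu_haar : normalized_haar mu.
Local Notation mu' := (mu : {measure set (vilenkin m) -> \bar R}).

(* The matrix of the characters of level [L] is square and its rows are
   orthogonal, hence so are its columns. *)
Lemma psi_orthogonal L i k : (i < M_ m L)%N -> (k < M_ m L)%N ->
  \sum_(a < M_ m L) psi R i (pt m a) * conjc (psi R k (pt m a)) =
  (M_ m L)%:R * (i == k)%:R.
Proof.
move=> iL kL; have M0 : (M_ m L)%:R != 0 :> R[i] by rewrite pnatr_eq0 -lt0n M_gt0.
pose A : 'M[R[i]]_(M_ m L) := \matrix_(a, i) psi R i (pt m a).
pose A' : 'M[R[i]]_(M_ m L) := \matrix_(i, a) ((M_ m L)%:R^-1 * conjc (psi R i (pt m a))).
have AA' : A *m A' = 1%:M.
  apply/matrixP => a b; rewrite !mxE.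
  transitivity ((M_ m L)%:R^-1 * dirichlet R (M_ m L) (pt m a) (pt m b)).
    by rewrite mulr_sumr; apply: eq_bigr => j _; rewrite !mxE; ring.
  rewrite (dirichlet_M R m_ge2); case: asboolP => [/(I_pt m_ge2)|] ab.
    rewrite mulVf//; move: ab; rewrite !modn_small// => /val_inj ->.
    by rewrite eqxx.
  rewrite mulr0; case: eqP => // E; exfalso; apply: ab; rewrite E.
  exact: I_refl.
have /matrixP/(_ (Ordinal kL) (Ordinal iL)) := mulmx1C AA'.
rewrite !mxE => /(congr1 (fun z => (M_ m L)%:R * z)); rewrite mulr_sumr eq_sym => <-.
by apply: eq_bigr => a _; rewrite !mxE/= !mulrA divff// mul1r mulrC.
Qed.

Lemma cintegrable_level N f : level_fun N f -> cintegrable mu' setT f.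
Proof.
move=> fN; split.
  have [] // := @integral_level R m m_ge2 mu mu_haar N (fun x => complex.Re (f x)).
  by move=> x y /fN ->.
have [] // := @integral_level R m m_ge2 mu mu_haar N (fun x => complex.Im (f x)).
by move=> x y /fN ->.
Qed.

Lemma cintegral_I_level n N f x : level_fun N f -> (N <= n)%N ->
  cintegral mu' (I_ n x) f = f x / (M_ m n)%:R.
Proof.
move=> fN Nn; have fx y : y \in I_ n x -> f y = f x.
  by move=> /set_mem xy; apply/esym/fN; exact: I_le xy.
have cst (p : R[i] -> R) :
    Rintegral mu' (I_ n x) (fun y => p (f y)) = p (f x) / (M_ m n)%:R.
  rewrite (@eq_Rintegral _ _ _ _ _ (fun=> p (f x))) => [|y /fx ->//].
  rewrite Rintegral_cst; last exact: measurable_I.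
  by rewrite mu_I.
rewrite /cintegral !cst -(rmorph_nat (real_complex R)) -fmorphV.
by case: (f x) => a b; apply/eqP; rewrite eq_complex/= !mulr0 subr0 add0r mulrC !eqxx.
Qed.

(** The kernel D_{M_n} is [M_ m n] times the indicator of the cylinder. *)
Lemma level_avg_fourier_sum n f x : cintegrable mu' setT f ->
  level_avg mu n f x = fourier_sum mu' (M_ m n) f x.
Proof.
move=> cf; rewrite (fourier_sum_level m_ge2 _ cf (leqnn _)).
rewrite /level_avg (cintegral_I m_ge2 _ cf (leqnn n)) mulr_sumr.
apply: eq_bigr => a _; rewrite (dirichlet_M R m_ge2) mulrA mulrC; congr (_ * _).
by case: asboolP => _; rewrite ?mulr1 ?mulr0.
Qed.

(* [psi_{M_N} D_{M_N}] *)
Definition block_poly N (x : vilenkin m) : R[i] := \sum_(k < M_ m N) psi R (M_ m N + k) x.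

Lemma M_double N : (M_ m N + M_ m N <= M_ m N.+1)%N.
Proof. by rewrite M_S addnn -muln2 leq_mul2l m_ge2 orbT. Qed.

Lemma block_poly_level N : level_fun N.+1 (block_poly N).
Proof.
move=> x y xy; apply: eq_bigr => k _; apply: (psi_I R m_ge2 _ xy).
by apply: leq_trans (M_double N); rewrite ltn_add2l.
Qed.

Lemma psi_addM N j (x : vilenkin m) : (j < M_ m N)%N ->
  psi R (M_ m N + j) x = psi R (M_ m N) x * psi R j x.
Proof. by move=> jN; have := psiMD R m_ge2 1 x jN; rewrite mul1n. Qed.

Lemma psi_near0 n j (x : vilenkin m) : (j < M_ m n)%N -> I_ n (pt m 0) x -> psi R j x = 1.
Proof.
move=> jn x0; rewrite -(psi_I R m_ge2 jn x0) /psi big1// => k _.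
rewrite rademacherE pt_val// /digit div0n mod0n mulr0 mul0r expi0 expr1n//.
Qed.

Lemma normc_block_poly N x :
  Normc.normc (block_poly N x) = (M_ m N)%:R * `[< I_ N (pt m 0) x >]%:R.
Proof.
have -> : block_poly N x = psi R (M_ m N) x * dirichlet R (M_ m N) x (pt m 0).
  rewrite mulr_sumr; apply: eq_bigr => k _; rewrite psi_addM//.
  by rewrite [psi R k (pt m 0)](@psi_near0 N) ?conjc1 ?mulr1.
rewrite Normc.normcM normc_psi mul1r (dirichlet_M R m_ge2).
case: asboolP => [/I_sym|] x0; first by rewrite asboolT// mulr1 normc_nat.
by rewrite asboolF ?mulr0 ?Normc.normc0// => /I_sym.
Qed.

Lemma fourier_coef_block N i : (i < M_ m N.+1)%N ->
  fourier_coef mu' (block_poly N) i = (M_ m N <= i < M_ m N + M_ m N)%:R.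
Proof.
move=> iN; rewrite /fourier_coef (@cintegral_mul_level _ _ m_ge2 _ N.+1); last 2 first.
- exact: cintegrable_level (@block_poly_level N).
- by move=> x y xy; rewrite (psi_I R m_ge2 iN xy).
have M0 : (M_ m N.+1)%:R != 0 :> R[i] by rewrite pnatr_eq0 -lt0n M_gt0.
transitivity (\sum_(k < M_ m N) (M_ m N + k == i)%N%:R : R[i]).
  transitivity (\sum_(a < M_ m N.+1) \sum_(k < M_ m N) (M_ m N.+1)%:R^-1 *
      (psi R (M_ m N + k) (pt m a) * conjc (psi R i (pt m a)))).
    apply: eq_bigr => a _; rewrite (cintegral_I_level _ (@block_poly_level N))//.
    by rewrite /block_poly mulr_suml mulr_sumr; apply: eq_bigr => k _; ring.
  rewrite exchange_big/=; apply: eq_bigr => k _.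
  rewrite -mulr_sumr psi_orthogonal ?mulKf//.
  by apply: leq_trans (M_double N); rewrite ltn_add2l.
case: (leqP (M_ m N) i) => /= Ni; last first.
  by rewrite big1// => k _; rewrite gtn_eqF// (leq_trans Ni)// leq_addr.
case: ltnP => iM.
  have kM : (i - M_ m N < M_ m N)%N by rewrite ltn_subLR.
  rewrite (bigD1 (Ordinal kM))//= subnKC// eqxx big1 ?addr0// => k /eqP ki.
  case: eqP => // E; case: ki; apply: val_inj => /=; by rewrite -E addKn.
by rewrite big1// => k _; rewrite ltn_eqF// (leq_trans _ iM)// ltn_add2l.
Qed.

Lemma fourier_sum_block_low N n x : (n <= M_ m N)%N ->
  fourier_sum mu' n (block_poly N) x = 0.
Proof.
move=> nN; apply: big1 => k _; have kN : (k < M_ m N)%N by apply: leq_trans nN.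
have kN' : (k < M_ m N.+1)%N by rewrite (leq_trans kN) ?leq_M.
by rewrite fourier_coef_block// leqNgt kN mul0r.
Qed.

(** For i < j <= M_n the character psi_i is 1 on I_n(0), so each of the last [j] terms equals
    psi_{M_N}. *)
Lemma fourier_sum_block N n j x : (n <= N)%N -> (j <= M_ m n)%N -> I_ n (pt m 0) x ->
  fourier_sum mu' (M_ m N + j) (block_poly N) x = psi R (M_ m N) x * j%:R.
Proof.
move=> nN jn x0; rewrite /fourier_sum big_split_ord/=.
rewrite [X in X + _](fourier_sum_block_low x (leqnn (M_ m N))).
have nNM : (M_ m n <= M_ m N)%N by rewrite leq_M.
rewrite add0r (eq_bigr (fun=> psi R (M_ m N) x)); last first.
  move=> i _; have iN : (i < M_ m n)%N by apply: leq_trans jn.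
  have iNN := leq_trans iN nNM.
  rewrite fourier_coef_block; last by apply: leq_trans (M_double N); rewrite ltn_add2l.
  by rewrite leq_addr ltn_add2l iNN mul1r psi_addM// (psi_near0 iN)// mulr1.
by rewrite sumr_const card_ord mulr_natr.
Qed.

(** Averages up to level [N] are partial sums below the first frequency, hence 0; later ones equal
    the function, of modulus M_N on I_N(0) and 0 elsewhere, which has integral 1. *)
Lemma hardy_norm_block N : (hardy_norm mu' (block_poly N) <= 1)%E.
Proof.
have cf := cintegrable_level (@block_poly_level N).
pose h x : R := (M_ m N)%:R * `[< I_ N (pt m 0) x >]%:R.
have h_level : level_fun N h by move=> x y xy; rewrite /h (level_I (pt m 0) (leqnn N) xy).
have h0 x : 0 <= h x by rewrite mulr_ge0.
have Hh x : (hardy_maximal mu' (block_poly N) x <= (h x)%:E)%E.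
  rewrite hardy_maximalE//; apply: ge_ereal_sup => _ [n _ <-]; rewrite lee_fin.
  case: (leqP n N) => nN.
    by rewrite level_avg_fourier_sum// fourier_sum_block_low ?leq_M// Normc.normc0.
  rewrite /level_avg (cintegral_I_level _ (@block_poly_level N))// mulrCA divff ?mulr1.
    by rewrite normc_block_poly.
  by rewrite pnatr_eq0 -lt0n M_gt0.
rewrite hardy_normE//; apply: (@le_trans _ _ (\int[mu']_x (h x)%:E)%E).
  apply: ge0_le_integral => //.
  - by move=> x _; exact: hardy_maximal_ge0.
  - exact: measurable_hardy_maximal.
  - by apply/measurable_EFinP; exact: measurable_level h_level.
have [_ ->] := integral_level m_ge2 mu_haar h_level.
rewrite lee_fin -mulr_sumr (sum_I m_ge2 mu_haar)// mulrA mulfK ?divff//;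
by rewrite pnatr_eq0 -lt0n M_gt0.
Qed.

(** Only the sums S_{M_N + j}, j < M_n, survive, with weights 1 / (M_n - j); [sum_div_subn]
    evaluates the result. *)
Lemma norlund_block N n x : (n <= N)%N -> I_ n (pt m 0) x ->
  Normc.normc (norlund_log_mean mu' (M_ m N + M_ m n) (block_poly N) x) =
  (M_ m n)%:R * (harmonic_sum R (M_ m n) - 1) / harmonic_sum R (M_ m N + M_ m n).
Proof.
move=> nN x0; rewrite /norlund_log_mean log_normE Normc.normcM Normc.normcV.
rewrite normc_real ger0_norm ?harmonic_sum_ge0// mulrC; congr (_ / _).
rewrite big_split_ord/= big1 ?add0r => [|k _]; last first.
  by rewrite fourier_sum_block_low ?mul0r// ltnW.
transitivity (Normc.normc (psi R (M_ m N) x *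
   (\sum_(j < M_ m n) j%:R / (M_ m n - j)%:R : R)%:C%C)).
  congr Normc.normc; rewrite rmorph_sum mulr_sumr; apply: eq_bigr => j _.
  rewrite (fourier_sum_block nN)//; last exact: ltnW.
  by rewrite subnDl rmorphM fmorphV !rmorph_nat mulrA.
rewrite Normc.normcM normc_psi mul1r normc_real sum_div_subn mulrBr mulr1.
rewrite ger0_norm// subr_ge0 ler_peMr//.
apply: (le_trans _ (harmonic_sum_homo R (M_gt0 m_ge2 n))).
by rewrite harmonic_sumS harmonic_sum0 add0r invr1.
Qed.

End partB.

Lemma sum_ord_natr (R : numFieldType) n :
  \sum_(k < n) k%:R = n%:R * (n%:R - 1) / 2 :> R.
Proof.
elim: n => [|n IH]; first by rewrite big_ord0 !mul0r.
by rewrite big_ord_recr/= IH -natr1; field.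
Qed.

(* Summation by parts against the decreasing indicators of [I_ n (pt m 0)]: at
   each point at most one difference is nonzero. *)
Lemma sum_shells_le (R : realDomainType) (b : nat -> bool) (c : nat -> R) (t : R) N :
  0 <= t -> {homo b : n k / (n <= k)%N >-> k -> n} ->
  (forall n, (n < N)%N -> b n -> c n <= t) ->
  \sum_(n < N) c n * ((b n)%:R - (b n.+1)%:R) <= t.
Proof.
move=> t0 bh ct.
have H K : (K <= N)%N ->
    \sum_(n < K) c n * ((b n)%:R - (b n.+1)%:R) <= t * ((b 0%N)%:R - (b K)%:R).
  elim: K => [|K IH] KN; first by rewrite big_ord0 subrr mulr0.
  rewrite big_ord_recr/= (le_trans (lerD (IH (ltnW KN)) (lexx _)))//.
  have := bh _ _ (leqnSn K); have := ct K KN.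
  case: (b K); case: (b K.+1) => cK bK.
  - by rewrite subrr mulr0 addr0.
  - by move: (cK isT); rewrite mulr1n mulr0n; lra.
  - by have := bK isT.
  - by rewrite subrr mulr0 addr0.
apply: (le_trans (H N (leqnn _))); rewrite -[leRHS]mulr1 ler_wpM2l//.
by case: (b 0%N); case: (b N); rewrite ?subr0 ?subrr ?sub0r ?lexx// (le_trans _ ler01)// oppr_le0.
Qed.

(** * Lower bound for the norms and divergence *)

Section unbounded.
Context (R : realType) (m : nat -> nat).
Hypothesis m_ge2 : forall k, (1 < m k)%N.
Context (mu : probability (vilenkin m) R).
Hypothesis mu_haar : normalized_haar mu.
Local Notation mu' := (mu : {measure set (vilenkin m) -> \bar R}).
Context (B : nat).
Hypothesis m_le : forall k, (m k <= B)%N.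

Lemma M_le_exp n : (M_ m n <= B ^ n)%N.
Proof.
elim: n => [|n IH]; first by rewrite M_0.
by rewrite M_S expnSr leq_mul.
Qed.

Let B2 : (1 < B)%N. Proof. exact: leq_trans (m_ge2 0) (m_le 0). Qed.
Let lnB_gt0 : 0 < ln (B%:R : R). Proof. by rewrite ln_gt0// ltr1n. Qed.

Lemma ln_M_le n : ln (M_ m n)%:R <= n%:R * ln (B%:R : R).
Proof.
rewrite mulr_natl -lnXn ?ltr0n ?(ltnW B2)// ler_ln ?posrE ?ltr0n ?M_gt0//.
  by rewrite -natrX ler_nat M_le_exp.
by rewrite exprn_gt0// ltr0n ltnW.
Qed.

Lemma measurable_weighted_maximal w f : measurable_fun setT (weighted_maximal mu' w f).
Proof.
pose u n x := (Normc.normc (norlund_log_mean mu' n f x) / w n)%:E.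
rewrite (_ : weighted_maximal mu' w f = fun x => esups (u ^~ x) 1%N).
  apply: measurable_fun_esups => n; apply: (measurable_level m_ge2 (N := n)).
  by move=> x y xy; rewrite /u (norlund_level_fun m_ge2 mu f (ltnW (ltn_M_ m_ge2 n)) xy).
by apply/funext => x; congr ereal_sup; apply/seteqP; split=> _ [n n0 <-]; exists n.
Qed.

(** The minorant [g] equals [c n] on the shell I_n(0) \ I_{n+1}(0), [n < N], of measure (1 - 1/m_n)
    / M_n >= 1 / (2 M_n); this shell contributes at least n / (4 D). *)
Lemma weighted_maximal_block phi N : (forall n, (0 < n)%N -> 1 <= phi n) ->
  (forall n k, (0 < n)%N -> (n <= k)%N -> phi n <= phi k) -> (1 < N)%N ->
  ((N.+2%:R / (48 * (1 + ln B%:R) * phi (M_ m N.+1)))%:E <=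
    norm1 mu' (weighted_maximal mu' phi (block_poly R N)))%E.
Proof.
move=> phi1 phi_homo N1; set F := weighted_maximal mu' phi (block_poly R N).
have phi0 n : (0 < n)%N -> 0 < phi n by move=> /phi1; exact: lt_le_trans.
(* By l_q <= 1 + (N+1) ln B for q <= M_{N+1}, this bounds [harmonic_sum R q * phi q] for all indices
   [q] used. *)
pose D : R := N.+1%:R * (1 + ln B%:R) * phi (M_ m N.+1).
have D0 : 0 < D by rewrite !mulr_gt0 ?phi0 ?M_gt0// addr_gt0.
pose b n x := `[< I_ n (pt m 0) x >].
pose c n : R := (M_ m n)%:R * (n%:R / 2) / D.
pose g x : R := \sum_(n < N) c n * ((b n x)%:R - (b n.+1 x)%:R).
have c0 n : 0 <= c n by rewrite !mulr_ge0 ?invr_ge0// ltW.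
have F0 x : (0 <= F x)%E by apply: weighted_maximal_ge0; rewrite ltW// phi0.
have bh x : {homo b^~ x : n k / (n <= k)%N >-> k -> n}.
  by move=> n k nk /asboolP H; apply/asboolP; exact: I_le H.
have cF n x : (n < N)%N -> b n x -> ((c n)%:E <= F x)%E.
  move=> nN /asboolP x0; apply: ereal_sup_ge; set q := (M_ m N + M_ m n)%N.
  have q0 : (0 < q)%N by rewrite addn_gt0 M_gt0.
  have qM : (q <= M_ m N.+1)%N.
    by rewrite (leq_trans _ (M_double m_ge2 N))// leq_add2l leq_M// ltnW.
  exists (Normc.normc (norlund_log_mean mu' q (block_poly R N) x) / phi q)%:E.
    by exists q.
  rewrite lee_fin norlund_block//; last exact: ltnW.
  have Hn : n%:R / 2 <= harmonic_sum R (M_ m n) - 1.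
    rewrite lerBrDl (le_trans (harmonic_sum_exp2 R n))//.
    by apply: harmonic_sum_homo; exact: expn2_le_M.
  have Hq : harmonic_sum R q <= N.+1%:R * (1 + ln B%:R).
    rewrite (le_trans (harmonic_sum_homo R qM))//.
    rewrite (le_trans (harmonic_sum_le_ln R (M_gt0 m_ge2 _)))// mulrDr mulr1.
    by rewrite lerD ?ln_M_le// ler1n.
  have Hq0 : 0 < harmonic_sum R q by exact: harmonic_sum_gt0.
  rewrite /c -[leRHS]mulrA -invfM; apply: ler_pM.
  - by rewrite mulr_ge0.
  - by rewrite invr_ge0 ltW.
  - by rewrite ler_wpM2l.
  have X0 : 0 < harmonic_sum R q * phi q by rewrite mulr_gt0 ?phi0.
  rewrite lef_pV2 ?posrE//; apply: ler_pM => //; try exact: ltW.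
    by rewrite ltW// phi0.
  exact: phi_homo.
have gF x : ((g x)%:E <= F x)%E.
  have := F0 x; case E : (F x) => [r| |] // r0; last by rewrite leey.
  rewrite lee_fin; apply: (sum_shells_le r0 (bh x)) => n nN bn.
  by rewrite -lee_fin -E; exact: cF.
have b_level n : (n <= N)%N -> level_fun N (b n).
  by move=> nN x y xy; rewrite /b (level_I (pt m 0) nN xy).
have g_level : level_fun N g.
  move=> x y xy; apply: eq_bigr => n _.
  by rewrite (b_level n (ltnW (ltn_ord n)) _ _ xy) (b_level n.+1 (ltn_ord n) _ _ xy).
have g0 x : 0 <= g x.
  apply: sumr_ge0 => n _; rewrite mulr_ge0// subr_ge0 ler_nat.
  have := bh x _ _ (leqnSn n); case: (b n.+1 x) => // ->//.
apply: (@le_trans _ _ (\int[mu']_x (g x)%:E)%E); last first.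
  rewrite /norm1; apply: ge0_le_integral => //.
  - by move=> x _; rewrite lee_fin.
  - by apply/measurable_EFinP; exact: measurable_level g_level.
  - by apply: measurableT_comp => //; exact: measurable_weighted_maximal.
  by move=> x _; rewrite gee0_abs.
have [_ ->] := integral_level m_ge2 mu_haar g_level.
rewrite lee_fin.
have M0 n : (M_ m n)%:R != 0 :> R by rewrite pnatr_eq0 -lt0n M_gt0.
have -> : (\sum_(a < M_ m N) g (pt m a)) / (M_ m N)%:R =
    \sum_(n < N) n%:R / 2 * (1 - (m n)%:R^-1) / D.
  rewrite exchange_big/= mulr_suml; apply: eq_bigr => n _.
  rewrite -mulr_sumr sumrB !(sum_I m_ge2 mu_haar)//; last exact: ltnW.
  have mn0 : (m n)%:R != 0 :> R by rewrite pnatr_eq0 -lt0n ltnW.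
  have D1 := lt0r_neq0 D0.
  rewrite /c M_S natrM; field.
  by rewrite D1 mn0 !M0.
apply: (@le_trans _ _ (\sum_(n < N) n%:R / 4 / D)); last first.
  apply: ler_sum => n _; rewrite ler_wpM2r ?invr_ge0 ?(ltW D0)//.
  have : (m n)%:R^-1 <= 2^-1 :> R by rewrite lef_pV2 ?posrE ?ltr0n ?ler_nat// ltnW.
  move=> mn; have -> : n%:R / 4 = n%:R / 2 * 2^-1 :> R by field.
  by rewrite ler_wpM2l//; lra.
rewrite -!mulr_suml sum_ord_natr.
set P := (1 + ln B%:R) * phi (M_ m N.+1).
have P0 : 0 < P by rewrite mulr_gt0 ?phi0 ?M_gt0// addr_gt0.
have -> : N.+2%:R / (48 * (1 + ln B%:R) * phi (M_ m N.+1)) = N.+2%:R / 48 / P :> R.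
  by rewrite -mulrA -/P invfM mulrA.
have -> : D = N.+1%:R * P by rewrite /D /P mulrA.
rewrite [(_ * P)^-1]invfM [leRHS]mulrA ler_wpM2r ?invr_ge0 ?(ltW P0)//.
rewrite ler_pdivlMr ?ltr0n// -[N.+2%:R]natr1 -[N.+1%:R]natr1.
(* What remains is (N+1)(N+2) <= 6 N (N-1), an equality at N = 2; this fixes the constant 48. *)
have : 2 <= N%:R :> R by rewrite ler_nat.
by nra.
Qed.

(** If M_{N+1} <= n < M_{N+2}, then log(n+1) / phi(n) is at most (N+2) ln B / phi(M_{N+1}), which
    boundedness of the operator would keep bounded. *)
Lemma unbounded_weighted_maximal phi : (forall n, (0 < n)%N -> 1 <= phi n) ->
  (forall n k, (0 < n)%N -> (n <= k)%N -> phi n <= phi k) ->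
  limn_esup (fun n => (ln (n.+1%:R : R) / phi n)%:E) = +oo%E ->
  ~ bounded_H1_L1 mu' (weighted_maximal mu' phi).
Proof.
move=> phi1 phi_homo limsup [C HC].
have phi0 n : (0 < n)%N -> 0 < phi n by move=> /phi1; exact: lt_le_trans.
(* [C] might be negative; [C'] is not, so the Hardy norm can be replaced by its bound 1. [A] is
   chosen to yield the lower bound [C' + 1]. *)
pose C' := Num.max C 0; pose A : R := 48 * (1 + ln B%:R) * ln B%:R * (C' + 1).
have bound N : (1 < N)%N -> N.+2%:R / (48 * (1 + ln B%:R) * phi (M_ m N.+1)) <= C'.
  move=> N1; rewrite -lee_fin.
  apply: (le_trans (weighted_maximal_block phi1 phi_homo N1)).
  have h1 := hardy_norm_block m_ge2 mu_haar N.
  have h0 : (0 <= hardy_norm mu' (block_poly R N))%E by exact: integral_ge0.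
  apply: (le_trans (HC _ _)).
    split.
      by have := cintegrable_level m_ge2 mu_haar (@block_poly_level R m m_ge2 N); exact.
    exact: le_lt_trans h1 (ltry _).
  apply: (@le_trans _ _ (C'%:E * hardy_norm mu' (block_poly R N))%E).
    by rewrite lee_wpmul2r// lee_fin le_max lexx.
  by rewrite -[leRHS]mule1 lee_wpmul2l// lee_fin le_max lexx orbT.
(* Requiring [M_ m 3 <= n] makes the [N] found below at least 2, as [weighted_maximal_block]
   demands. *)
have [n nM An] : exists2 n, (M_ m 3 <= n)%N & A <= ln n.+1%:R / phi n.
  apply: contrapT => H; suff : (limn_esup (fun n => (ln (n.+1%:R : R) / phi n)%:E) <= A%:E)%E.
    by rewrite limsup leye_eq.
  rewrite /limn_esup limf_esupE; apply: ereal_inf_le.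
  exists (ereal_sup ((fun n => (ln (n.+1%:R : R) / phi n)%:E) @` [set n | (M_ m 3 <= n)%N])).
    by exists [set n | (M_ m 3 <= n)%N] => //; exists (M_ m 3).
  apply: ge_ereal_sup => _ [n nM <-]; rewrite lee_fin leNgt; apply/negP => /ltW An.
  by apply: H; exists n.
have ex : exists N, (M_ m N <= n)%N by exists 3%N.
have bnd N : (M_ m N <= n)%N -> (N <= n)%N.
  by move=> MN; apply: leq_trans MN; exact: ltnW (ltn_M_ m_ge2 N).
case: (ex_maxnP ex bnd) => -[//|N] NM Nmax; first by have := Nmax _ nM.
have N1 : (1 < N)%N by rewrite -ltnS Nmax.
have nN2 : (n < M_ m N.+2)%N by rewrite ltnNge; apply/negP => /Nmax; rewrite ltnn.
have n0 : (0 < n)%N by apply: leq_trans NM; exact: M_gt0.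
have := bound N N1; apply/negP; rewrite -ltNge.
apply: (@lt_le_trans _ _ (C' + 1)); first by rewrite ltrDl.
have lnn : ln n.+1%:R <= N.+2%:R * ln (B%:R : R).
  apply: le_trans (ln_M_le _); rewrite ler_ln ?posrE ?ltr0n ?M_gt0//.
  by rewrite ler_nat.
have K0 : 0 < 48 * (1 + ln B%:R) * ln B%:R :> R by rewrite !mulr_gt0// addr_gt0.
rewrite -(ler_pM2l K0) -/A (le_trans An)//.
apply: (@le_trans _ _ (N.+2%:R * ln B%:R / phi (M_ m N.+1))).
  rewrite ler_pM ?invr_ge0 ?ln_ge0 ?ler1n ?(ltW (phi0 _ n0))//.
  by rewrite lef_pV2 ?posrE ?phi0 ?M_gt0// phi_homo// M_gt0.
rewrite le_eqVlt; apply/orP; left; apply/eqP.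
have p0 := lt0r_neq0 (phi0 _ (M_gt0 m_ge2 N.+1)).
have l0 : 1 + ln B%:R != 0 :> R by rewrite gt_eqF// addr_gt0.
by field; rewrite p0 l0.
Qed.

End unbounded.

Theorem theorem2 (R : realType) (m : nat -> nat)
  (m_ge2 : forall k, (1 < m k)%N)
  (m_bounded : exists B, forall k, (m k <= B)%N)
  (mu : probability (vilenkin m) R) (mu_haar : normalized_haar mu) :
  bounded_H1_L1 mu (weighted_maximal mu (fun n => ln (n.+1%:R : R)))
  /\
  (forall phi : nat -> R,
     (forall n, (0 < n)%N -> 1 <= phi n) ->
     (forall n k, (0 < n)%N -> (n <= k)%N -> phi n <= phi k) ->
     limn_esup (fun n => (ln (n.+1%:R : R) / phi n)%:E) = +oo%E ->
     ~ bounded_H1_L1 mu (weighted_maximal mu phi)).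
Proof.
have [B m_le] := m_bounded; split; first exact: bounded_log_maximal m_le mu mu_haar.
by move=> phi; exact: (unbounded_weighted_maximal m_ge2 mu_haar m_le).
Qed.
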